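(* Let $f\in\mathscr{B}^p_{c,T}$, where $p\in[1,+\infty]$, $c\in\mathbb{R}$ and $T>0$. Then $$\bigl\|(\widetilde{\Theta}_cf)(\cdot,\theta)\bigr\|_{X_c^p}\le T\,\bigl\|f(\cdot,\theta)\bigr\|_{X_c^p}$$ for any $\theta\in\mathbb{R}$.
   Context: $\mathbb{H}:=\{(r,\theta): r\in\mathbb{R}^+,\ \theta\in\mathbb{R}\}$ with $\mathbb{R}^+=(0,\infty)$. A function $f:\mathbb{H}\to\mathbb{C}$ is polar-analytic on $\mathbb{H}$ if for every $(r_0,\theta_0)\in\mathbb{H}$ the limit $$(D_{\rm pol}f)(r_0,\theta_0):=\lim_{(r,\theta)\to(r_0,\theta_0)}\frac{f(r,\theta)-f(r_0,\theta_0)}{re^{i\theta}-r_0e^{i\theta_0}}$$ exists. The polar Mellin derivative is $(\widetilde{\Theta}_cf)(r,\theta):=re^{i\theta}(D_{\rm pol}f)(r,\theta)+c f(r,\theta)$. For $c\in\mathbb{R}$ and $1\le p<\infty$, $X_c^p$ is the space of measurable $\varphi:\mathbb{R}^+\to\mathbb{C}$ with $\|\varphi\|_{X_c^p}:=\bigl(\int_0^\infty r^{cp}|\varphi(r)|^p\frac{dr}{r}\bigr)^{1/p}<\infty$; $X_c^\infty$ is the space of measurable $\varphi$ with $\|\varphi\|_{X_c^\infty}:=\sup_{r>0}r^c|\varphi(r)|<\infty$. The Mellin--Bernstein space $\mathscr{B}^p_{c,T}$ ($T>0$) consists of all $f:\mathbb{H}\to\mathbb{C}$ such that (i) $f$ is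 polar-analytic on $\mathbb{H}$; (ii) $f(\cdot,0)\in X_c^p$; (iii) there is a constant $C_f>0$ with $r^c|f(r,\theta)|\le C_fe^{T|\theta|}$ for all $(r,\theta)\in\mathbb{H}$. *)

(* Defs.v *)
From HB Require Import structures.
From mathcomp Require Import all_boot all_order all_algebra.
From mathcomp Require Import all_classical all_reals all_analysis.
From mathcomp Require Import complex.
Set Implicit Arguments.
Unset Strict Implicit.
Unset Printing Implicit Defensive.
Import Order.TTheory GRing.Theory Num.Theory.
Import numFieldNormedType.Exports.

Local Open Scope classical_set_scope.
Local Open Scope ring_scope.
Local Open Scope complex_scope.

(* Functions on H = ]0, +oo[ x R are represented by total functions
   f : R * R -> R[i], and functions on ]0, +oo[ by total functions R -> R[i].
   Only the values at points with r > 0 matter: norms and conditions range over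
   r > 0, and H is open in R * R, so limits at points of H ignore the rest. *)

Section Polar.
Variable R : realType.
Implicit Types (f : R * R -> R[i]) (phi : R -> R[i]) (c T : R) (p : \bar R).

Definition halfline : set R := `]0, +oo[.

Definition halfplane : set (R * R) := [set x | 0 < x.1].

(* (r, theta) |-> r e^{i theta}; it is not injective on H, but it is locally
   injective, so polar_quotient f x has nonzero denominators on a punctured
   neighbourhood of x. The codomain of polar_quotient is R[i]^o because that is
   the type on which the library puts the topology given by the modulus. *)
Definition polar (x : R * R) : R[i] := x.1%:C * (cos x.2 +i* sin x.2).

Definition polar_quotient f (x y : R * R) : R[i]^o :=
  (f y - f x) / (polar y - polar x) : R[i].

Definition polar_analytic f : Prop :=
  forall x, halfplane x -> cvg (polar_quotient f x y @[y --> x^']).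

Definition Dpol f (x : R * R) : R[i] := lim (polar_quotient f x y @[y --> x^']).

Definition polar_mellin c f (x : R * R) : R[i] :=
  polar x * Dpol f x + c%:C * f x.

(* The R-valued modulus: `|z| itself has type R[i]. *)
Definition cabs (z : R[i]) : R := complex.Re `|z|.

(* The norm takes values in [0, +oo]; for p = +oo it is a supremum, not an
   essential supremum. The case p = -oo is a dummy, and only 1 <= p is
   meaningful. *)
Definition Xnorm c p phi : \bar R :=
  match p with
  | q%:E => poweR (\int[lebesgue_measure]_(r in halfline)
              (r `^ (c * q) * cabs (phi r) `^ q / r)%:E)%E q^-1
  | +oo%E => ereal_sup [set (r `^ c * cabs (phi r))%:E | r in halfline]
  | -oo%E => 0%E
  end.

Definition complex_measurable phi : Prop :=
  measurable_fun halfline (fun r => complex.Re (phi r)) /\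
  measurable_fun halfline (fun r => complex.Im (phi r)).

Definition Xspace c p : set (R -> R[i]) :=
  [set phi | complex_measurable phi /\ (Xnorm c p phi < +oo)%E].

Definition mellin_bernstein c p T : set (R * R -> R[i]) :=
  [set f | [/\ polar_analytic f,
               Xspace c p (fun r => f (r, 0)) &
               exists2 C : R, 0 < C & forall r theta : R, 0 < r ->
                 r `^ c * cabs (f (r, theta)) <= C * expR (T * `|theta|)]].

End Polar.

(* Main.v *)
(** Put [g z = e^(c z) f (e^x, y)] for [z = x + i y]. Polar analyticity makes [g]
    entire with [g' z = e^(c z) (polar_mellin c f) (e^x, y)], and condition (iii)
    reads [|g (x + i y)| <= C e^(T |y|)]. Integrating [g z / (z^2 cos (T z))] over
    large squares gives M. Riesz' interpolation formula
      [g' z = sum_k (-1)^k w_k (g (z + p_k) - g (z - p_k)) T / 2],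
    where [p_k = (2 k + 1) pi / (2 T)], [w_k > 0] and [sum_k w_k = 1]. So [|g'| / T] is
    dominated by an average of real translates of [|g|], and the norm inequality
    follows from the convexity of [t^q] and the invariance of [dr / r] under
    dilations. The complex derivative of [g] is not known to be continuous, so
    Cauchy's theorem is obtained for rectangles by Goursat's bisection. *)

Require Import Defs.
From mathcomp Require Import all_boot all_order all_algebra.
From mathcomp Require Import all_classical all_reals all_analysis.
From mathcomp Require Import complex.
From mathcomp Require Import measurable_realfun.
From mathcomp Require Import ring lra.
Set Implicit Arguments.
Unset Strict Implicit.
Unset Printing Implicit Defensive.
Import Order.TTheory GRing.Theory Num.Theory.
Import numFieldNormedType.Exports.
Local Open Scope classical_set_scope.
Local Open Scope ring_scope.
Local Open Scope complex_scope.

(** * Complex modulus and complex derivative *)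

Section Cabs.
Variable R : realType.
Implicit Types (z w : R[i]) (x : R).

(** Logarithmic coordinates map [H] bijectively onto the complex plane, so no periodicity in the
    angle is involved, and they turn dilations of [r] into real translations. The kernel
    [1 / (z^2 cos (T z))] is shaped by the growth condition: off its zeros the cosine grows like
    [e^(T |y|)] and absorbs the growth of [g], while [z^2] makes the integral over a square of
    half-side [a] of order [1 / a] and produces the derivative at 0 as a residue. Only simple poles
    are treated; the double pole at 0 is avoided by replacing [g] by its odd part, which has the
    same derivative at 0. The interpolation formula is kept with [n] nodes and an error of order
    [1 / n], and [n] tends to infinity only after moduli have been taken, so no series of complex
    numbers occurs. For the same reason [sum_k w_k <= 1] is all that has to be known about the
    weights. The angle enters only through a factor [e^(T |theta|)] in the error term, which is why
    the constant [T] is the same on every ray. *)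

Lemma normcabs z : `|z| = (cabs z)%:C.
Proof. by rewrite /cabs normc_def. Qed.

Lemma cabsE z : cabs z = Num.sqrt (complex.Re z ^+ 2 + complex.Im z ^+ 2).
Proof. by rewrite /cabs normc_def. Qed.

Lemma cabs_sqr z : cabs z ^+ 2 = complex.Re z ^+ 2 + complex.Im z ^+ 2.
Proof. by rewrite cabsE sqr_sqrtr // addr_ge0 // sqr_ge0. Qed.

Lemma cabs_ge0 z : 0 <= cabs z.
Proof. by rewrite cabsE sqrtr_ge0. Qed.

Lemma cabs0 : cabs (0 : R[i]) = 0.
Proof. by rewrite /cabs normr0. Qed.

Lemma cabsM z w : cabs (z * w) = cabs z * cabs w.
Proof. by apply: complexI; rewrite rmorphM /= -!normcabs normrM. Qed.

Lemma cabsV z : cabs z^-1 = (cabs z)^-1.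
Proof. by apply: complexI; rewrite fmorphV /= -!normcabs normfV. Qed.

Lemma cabsN z : cabs (- z) = cabs z.
Proof. by rewrite /cabs normrN. Qed.

Lemma cabsC z w : cabs (z - w) = cabs (w - z).
Proof. by rewrite -cabsN opprB. Qed.

Lemma cabsD z w : cabs (z + w) <= cabs z + cabs w.
Proof. by rewrite -lecR rmorphD /= -!normcabs ler_normD. Qed.

Lemma cabsB z w : cabs (z - w) <= cabs z + cabs w.
Proof. by rewrite -(cabsN w) cabsD. Qed.

Lemma cabs_eq0 z : (cabs z == 0) = (z == 0).
Proof. by rewrite -(inj_eq (@complexI R)) -normcabs normr_eq0. Qed.

Lemma cabs_gt0 z : (0 < cabs z) = (z != 0).
Proof. by rewrite lt_def cabs_ge0 andbT cabs_eq0. Qed.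

Lemma cabsR x : cabs x%:C = `|x|.
Proof. by rewrite cabsE /= expr0n addr0 sqrtr_sqr. Qed.

Lemma cabs_i : cabs ('i%C : R[i]) = 1.
Proof. by rewrite cabsE /= expr0n add0r expr1n sqrtr1. Qed.

Lemma cabs_sum (I : Type) (r : seq I) (P : pred I) (F : I -> R[i]) :
  cabs (\sum_(j <- r | P j) F j) <= \sum_(j <- r | P j) cabs (F j).
Proof.
elim/big_ind2: _ => // [|x1 x2 y1 y2 h1 h2]; first by rewrite cabs0.
by rewrite (le_trans (cabsD _ _))// lerD.
Qed.

Lemma Re_le_cabs z : `|complex.Re z| <= cabs z.
Proof. by rewrite cabsE -sqrtr_sqr ler_wsqrtr// lerDl sqr_ge0. Qed.

Lemma Im_le_cabs z : `|complex.Im z| <= cabs z.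
Proof. by rewrite cabsE -sqrtr_sqr ler_wsqrtr// lerDr sqr_ge0. Qed.

Lemma cabs_le z : cabs z <= `|complex.Re z| + `|complex.Im z|.
Proof.
rewrite -ler_sqr ?nnegrE ?cabs_ge0// ?addr_ge0// cabs_sqr.
rewrite -(real_normK (num_real (complex.Re z))) -(real_normK (num_real (complex.Im z))).
have := normr_ge0 (complex.Re z); have := normr_ge0 (complex.Im z); nra.
Qed.

Lemma cabs_sub_le z w : cabs z - cabs w <= cabs (z - w).
Proof. by rewrite lerBlDr -{1}(subrK w z) cabsD. Qed.

End Cabs.

Section Deriv.
Variable R : realType.
Local Notation C := (R[i])^o.
Implicit Types (F G : R[i] -> R[i]) (z w d : R[i]).

(** Without division the case [w = z] needs no exclusion, and both radii are real. The equivalence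
    [cderivP] with the library derivative gives access to its algebraic rules. *)
Definition cderiv F z d : Prop :=
  forall e : R, 0 < e -> exists2 del : R, 0 < del &
    forall w, cabs (w - z) < del ->
      cabs (F w - F z - d * (w - z)) <= e * cabs (w - z).

Lemma cderivP F z d : cderiv F z d <-> is_derive (z : C) (1 : C) (F : C -> C) (d : C).
Proof.
split => [h|[h1 h2]].
  have H : (fun h : C => h^-1 *: (((F : C -> C) \o shift (z : C)) (h *: (1 : C)) - F z))
      @ 0^' --> (d : C).
    apply/cvgrPdist_le => e e0.
    (* In the order of [R[i]] a positive element is real. *)
    have [er e0r eE] : exists2 er : R, 0 < er & e = er%:C.
      exists (complex.Re e); last by rewrite RRe_real// gtr0_real.
      by move: e0; rewrite ltcE => /andP[_].
    subst e. have [del d0 hd] := h _ e0r.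
    near=> u.
    have u0 : u != 0 by near: u; exact: nbhs_dnbhs_neq.
    have ud : cabs u < del.
      have : `|u| < del%:C.
        near: u; apply: dnbhs0_lt. by rewrite ltcR.
      by rewrite normcabs ltcR.
    have := hd (u + z); rewrite addrK => /(_ ud) hh.
    rewrite normcabs lecR cabsC /=.
    rewrite -(@ler_pM2r _ (cabs u)) ?cabs_gt0// -cabsM /shift/=.
    have -> : (u^-1 *: (F (u *: (1 : C) + z) - F z) - d) * u = F (u + z) - F z - d * u.
      by rewrite /GRing.scale /= mulr1; field.
    exact: hh.
  by split; [apply/cvg_ex; exists d | exact: cvg_lim].
have {h1 h2}H : (fun h : C => h^-1 *: (((F : C -> C) \o shift (z : C)) (h *: (1 : C)) - F z))
      @ 0^' --> (d : C).
  by rewrite -h2; exact: h1.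
move=> e e0.
have : (0 : C) < e%:C by rewrite ltcR.
move/cvgrPdist_le : H => /[apply].
rewrite /nbhs /= /dnbhs /within /= => /nbhs_ballP[r r0 hr].
have [rr r0r rE] : exists2 er : R, 0 < er & r = er%:C.
  exists (complex.Re r); last by rewrite RRe_real// gtr0_real.
  by move: r0; rewrite /= ltcE => /andP[_].
subst r. exists rr => // w hw.
have [->|wz] := eqVneq w z; first by rewrite !subrr mulr0 subr0 cabs0 mulr0.
have w0 : w - z != 0 by rewrite subr_eq0.
have := hr (w - z); rewrite /ball /= sub0r normrN normcabs ltcR => /(_ hw w0).
rewrite normcabs lecR -(@ler_pM2r _ (cabs (w-z))) ?cabs_gt0// -cabsM => hh.
apply: le_trans hh; rewrite -cabsN le_eqVlt; apply/orP; left; apply/eqP.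
congr cabs; rewrite /= /GRing.scale /= mulr1 subrK; field.
by [].
Unshelve. all: by end_near. Qed.

End Deriv.

Section DerivRules.
Variable R : realType.
Local Notation C := (R[i])^o.
Implicit Types (F G : R[i] -> R[i]) (z w d : R[i]).

Lemma cderiv_eq F z d d' : cderiv F z d -> d = d' -> cderiv F z d'.
Proof. by move=> ? <-. Qed.

Lemma cderiv_ext F G z d : F =1 G -> cderiv F z d -> cderiv G z d.
Proof. by move=> /funext ->. Qed.

Lemma cderiv_cst k z : cderiv (fun=> k) z 0.
Proof. by apply/cderivP; exact: is_derive_cst. Qed.

Lemma cderiv_id z : cderiv (fun w => w) z 1.
Proof. by apply/cderivP; exact: is_derive_id. Qed.

Lemma cderivD F G z d e : cderiv F z d -> cderiv G z e ->
  cderiv (fun w => F w + G w) z (d + e).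
Proof. by move=> /cderivP hF /cderivP hG; apply/cderivP; exact: is_deriveD. Qed.

Lemma cderivN F z d : cderiv F z d -> cderiv (fun w => - F w) z (- d).
Proof. by move=> /cderivP hF; apply/cderivP; exact: is_deriveN. Qed.

Lemma cderivB F G z d e : cderiv F z d -> cderiv G z e ->
  cderiv (fun w => F w - G w) z (d - e).
Proof. by move=> hF hG; apply: cderivD => //; exact: cderivN. Qed.

Lemma cderivM F G z d e : cderiv F z d -> cderiv G z e ->
  cderiv (fun w => F w * G w) z (F z * e + G z * d).
Proof. by move=> /cderivP hF /cderivP hG; apply/cderivP; exact: is_deriveM. Qed.

Lemma cderivZ k F z d : cderiv F z d -> cderiv (fun w => k * F w) z (k * d).
Proof.
move=> hF; apply: cderiv_eq (cderivM (cderiv_cst k z) hF) _.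
by rewrite mulr0 addr0.
Qed.

Lemma cderivV F z d : F z != 0 -> cderiv F z d ->
  cderiv (fun w => (F w)^-1) z (- (F z) ^- 2 * d).
Proof.
move=> Fz /cderivP[h1 h2]; apply/cderivP; split.
  exact: (@derivableV _ _ (F : C -> C)).
by rewrite (@deriveV _ _ (F : C -> C))// h2.
Qed.

Lemma cderiv_affine F a b z d : cderiv F (a * z + b) d ->
  cderiv (fun w => F (a * w + b)) z (a * d).
Proof.
move=> hF e e0.
(* The shift by 1 covers [a = 0]. *)
have a1 : 0 < cabs a + 1 by rewrite ltr_wpDl// cabs_ge0.
have [del del0 h] := hF (e / (cabs a + 1)) (divr_gt0 e0 a1).
exists (del / (cabs a + 1)); first exact: divr_gt0.
move=> w; rewrite ltr_pdivlMr// => hw.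
have E : a * w + b - (a * z + b) = a * (w - z) by ring.
have := h (a * w + b); rewrite E cabsM.
have le1 : cabs a * cabs (w - z) <= cabs (w - z) * (cabs a + 1).
  by rewrite mulrC ler_wpM2l ?cabs_ge0// lerDl.
move=> /(_ (le_lt_trans le1 hw)).
rewrite mulrCA mulrA => /le_trans; apply.
by rewrite -mulrA ler_wpM2l ?(ltW e0)// ler_pdivrMl// [leRHS]mulrC.
Qed.

Lemma cderiv_continuous F z d : cderiv F z d -> forall e : R, 0 < e ->
  exists2 del : R, 0 < del & forall w, cabs (w - z) < del -> cabs (F w - F z) < e.
Proof.
move=> hF e e0; have [del del0 h] := hF 1 ltr01.
have d1 : 0 < cabs d + 1 by rewrite ltr_wpDl// cabs_ge0.
exists (Num.min del (e / (cabs d + 1))).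
  by rewrite lt_min del0 divr_gt0.
move=> w; rewrite lt_min ltr_pdivlMr// => /andP[/h {}h hw].
apply: le_lt_trans hw.
rewrite -(subrK (d * (w - z)) (F w - F z)) (le_trans (cabsD _ _))//.
by rewrite cabsM; move: h; rewrite mul1r; lra.
Qed.

End DerivRules.

(** * Continuity along horizontal and vertical segments *)

Section PathContinuity.
Variable R : realType.

(** Continuity is two-sided even at [a] and [b]: the paths run through points at which a function of
    a complex variable is differentiable, so nothing is lost at the ends. *)
Definition cseg (F : R -> R[i]) (a b : R) := forall t, a <= t <= b ->
  {for t, continuous (fun s => complex.Re (F s))} /\
  {for t, continuous (fun s => complex.Im (F s))}.

(** A path with [|g s - g t| <= |s - t|] covers both kinds of segment, and an additive map [p] with
    [|p z| <= |z|] covers both the real and the imaginary part. *)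
Lemma cderiv_path (F : R[i] -> R[i]) (g : R -> R[i]) t d :
  (forall s, cabs (g s - g t) <= `|s - t|) -> cderiv F (g t) d ->
  {for t, continuous (fun s => complex.Re (F (g s)))} /\
  {for t, continuous (fun s => complex.Im (F (g s)))}.
Proof.
move=> hg /cderiv_continuous hF.
suff H (p : R[i] -> R) : (forall z w, p (z - w) = p z - p w) ->
    (forall z, `|p z| <= cabs z) -> {for t, continuous (fun s => p (F (g s)))}.
  by split; apply: H; [case=> ? ? [] | exact: Re_le_cabs | case=> ? ? [] | exact: Im_le_cabs].
move=> pB ple; apply/cvgrPdist_lt => e e0.
have [del del0 h] := hF _ e0.
near=> s; rewrite distrC -pB (le_lt_trans (ple _))// h//.
rewrite (le_lt_trans (hg _))// distrC.
Unshelve. all: by end_near. Qed.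

Lemma horizontal_dist (c s t : R) : cabs (s +i* c - (t +i* c)) <= `|s - t|.
Proof. by rewrite (le_trans (cabs_le _))//= subrr normr0 addr0. Qed.

Lemma vertical_dist (c s t : R) : cabs (c +i* s - (c +i* t)) <= `|s - t|.
Proof. by rewrite (le_trans (cabs_le _))//= subrr normr0 add0r. Qed.

End PathContinuity.

(** * Complex integrals over segments *)

Section Cint.
Variable R : realType.
Notation mu := (@lebesgue_measure R).
Implicit Types (F G : R -> R[i]) (a b : R).

Definition cint F a b : R[i] :=
  (\int[mu]_(x in `[a, b]) complex.Re (F x)) +i*
  (\int[mu]_(x in `[a, b]) complex.Im (F x)).

Lemma cont_integrable (f : R -> R) a b : (forall t, a <= t <= b -> {for t, continuous f}) ->
  mu.-integrable `[a, b] (EFin \o f).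
Proof.
move=> h; apply: continuous_compact_integrable; first exact: segment_compact.
by apply: continuous_in_subspaceT => x; rewrite inE/= in_itv/= => /h.
Qed.

Lemma cseg_intRe F a b : cseg F a b -> mu.-integrable `[a, b] (EFin \o (fun x => complex.Re (F x))).
Proof. by move=> h; apply: cont_integrable => t /h[]. Qed.

Lemma cseg_intIm F a b : cseg F a b -> mu.-integrable `[a, b] (EFin \o (fun x => complex.Im (F x))).
Proof. by move=> h; apply: cont_integrable => t /h[]. Qed.

Lemma ReB (z w : R[i]) : complex.Re (z - w) = complex.Re z - complex.Re w.
Proof. by case: z w => [? ?] []. Qed.
Lemma ImB (z w : R[i]) : complex.Im (z - w) = complex.Im z - complex.Im w.
Proof. by case: z w => [? ?] []. Qed.
Lemma ReM (z w : R[i]) :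
  complex.Re (z * w) = complex.Re z * complex.Re w - complex.Im z * complex.Im w.
Proof. by case: z w => [? ?] []. Qed.
Lemma ImM (z w : R[i]) :
  complex.Im (z * w) = complex.Re z * complex.Im w + complex.Im z * complex.Re w.
Proof. by case: z w => [? ?] [? ?]/=. Qed.

Lemma csegB F G a b : cseg F a b -> cseg G a b -> cseg (fun x => F x - G x) a b.
Proof.
move=> hF hG t ht; have [? ?] := hF t ht; have [? ?] := hG t ht.
split; [rewrite (funext (fun s => ReB (F s) (G s)))|
        rewrite (funext (fun s => ImB (F s) (G s)))]; exact: continuousB.
Qed.

Lemma csegZ k F a b : cseg F a b -> cseg (fun x => k * F x) a b.
Proof.
move=> hF t ht; have [? ?] := hF t ht.
split; [rewrite (funext (fun s => ReM k (F s))); apply: continuousB|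
        rewrite (funext (fun s => ImM k (F s))); apply: continuousD];
  by apply: continuousM => //; exact: cst_continuous.
Qed.

Lemma cintB F G a b : cseg F a b -> cseg G a b ->
  cint (fun x => F x - G x) a b = cint F a b - cint G a b.
Proof.
move=> hF hG; rewrite /cint.
under eq_Rintegral do rewrite ReB.
rewrite RintegralB//; [|exact: cseg_intRe..].
under [X in _ +i* X]eq_Rintegral do rewrite ImB.
by rewrite RintegralB//; exact: cseg_intIm.
Qed.

Lemma cintZ k F a b : cseg F a b -> cint (fun x => k * F x) a b = k * cint F a b.
Proof.
move=> hF; rewrite /cint.
have iZ (r : R) f : (forall t, a <= t <= b -> {for t, continuous f}) ->
    mu.-integrable `[a, b] (EFin \o (fun x => r * f x)).
  move=> h; apply: cont_integrable => t /h ft.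
  by apply: continuousM => //; exact: cst_continuous.
have iZRe r := iZ r _ (fun t ht => (hF t ht).1).
have iZIm r := iZ r _ (fun t ht => (hF t ht).2).
have [h1 h2] := (cseg_intRe hF, cseg_intIm hF).
under eq_Rintegral do rewrite ReM.
rewrite RintegralB//.
under [X in _ +i* X]eq_Rintegral do rewrite ImM.
rewrite RintegralD//.
by rewrite !RintegralZl//; case: k.
Qed.

Lemma cint_split F a b c : a <= b -> b <= c -> cseg F a c ->
  cint F a c = cint F a b + cint F b c.
Proof.
move=> ab bc hF.
have H f : mu.-integrable `[a, c] (EFin \o f) ->
   \int[mu]_(x in `[a, c]) f x = \int[mu]_(x in `[a, b]) f x + \int[mu]_(x in `[b, c]) f x.
  move=> fi.
  have := @Rintegral_itvB _ f (BLeft a) (BRight c) b fi.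
  rewrite !bnd_simp => /(_ ab bc) E.
  rewrite -(@Rintegral_itv_obnd_cbnd _ b (BRight c)); last first.
    apply: integrableS fi => //; apply: subset_itvr; rewrite bnd_simp//.
  by rewrite -E addrC subrK.
by rewrite /cint !H//; [exact: cseg_intIm|exact: cseg_intRe].
Qed.

Lemma Rint_bound (f : R -> R) a b M k : a <= b ->
  mu.-integrable `[a, b] (EFin \o f) -> (forall x, a <= x <= b -> `|f x - k| <= M) ->
  `|\int[mu]_(x in `[a, b]) f x - k * (b - a)| <= M * (b - a).
Proof.
move=> ab fi h.
have ci r : mu.-integrable `[a, b] (EFin \o cst r).
  by apply: cont_integrable => t _; exact: cst_continuous.
have E r : \int[mu]_(x in `[a, b]) r = r * (b - a).
  rewrite Rintegral_cst//= lebesgue_measure_itv/= lte_fin.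
  by case: ltgtP ab => [ab _|//|-> _]; rewrite ?subrr ?mulr0//.
rewrite -E -(E M) -RintegralB//; last exact: ci.
have fki : mu.-integrable `[a, b] (EFin \o (fun x => f x - k)).
  by apply: (integrableB _ fi (ci k)).
apply: (le_trans (le_normr_Rintegral _ fki)) => //.
apply: le_Rintegral => //.
- exact: (integrable_norm fki).
- exact: (ci M).
Qed.

(** The factor 2 comes from bounding real and imaginary parts separately. It is harmless, since the
    bound is only used for quantities that become arbitrarily small. *)
Lemma cint_bound F a b M k : a <= b -> cseg F a b ->
  (forall x, a <= x <= b -> cabs (F x - k) <= M) ->
  cabs (cint F a b - k * (b - a)%:C) <= 2 * M * (b - a).
Proof.
move=> ab hF h; rewrite (le_trans (cabs_le _))// /cint.
rewrite ReB ImB ReM ImM/= !mulr0 add0r subr0.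
have -> : 2 * M * (b - a) = M * (b - a) + M * (b - a) by ring.
apply: lerD; apply: Rint_bound => //; [exact: cseg_intRe| |exact: cseg_intIm|] => x hx.
  by rewrite -ReB (le_trans (Re_le_cabs _))// h.
by rewrite -ImB (le_trans (Im_le_cabs _))// h.
Qed.

End Cint.

(** * Goursat's theorem and residues on rectangles *)

Section Goursat.
Variable R : realType.
Implicit Types (F : R[i] -> R[i]) (a b c d x y : R).

(* Counterclockwise integral of [F dz] along the boundary of [a, b] x [c, d],
   with opposite sides paired so that only differences of [F] are integrated. *)
Definition rint F a b c d : R[i] :=
  cint (fun x => F (x +i* c) - F (x +i* d)) a b +
  'i%C * cint (fun y => F (b +i* y) - F (a +i* y)) c d.

Definition holo F (z : R[i]) := exists e, cderiv F z e.

Definition holo_rect F a b c d :=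
  forall x y, a <= x <= b -> c <= y <= d -> holo F (x +i* y).

Lemma holo_rect_sub F a b c d a' b' c' d' : a <= a' -> b' <= b -> c <= c' -> d' <= d ->
  holo_rect F a b c d -> holo_rect F a' b' c' d'.
Proof.
move=> aa bb cc dd h x y /andP[h1 h2] /andP[h3 h4].
by apply: h; apply/andP; split;
  [exact: le_trans h1|exact: le_trans bb|exact: le_trans h3|exact: le_trans dd].
Qed.

Lemma cseg_hor F a b y : (forall x, a <= x <= b -> holo F (x +i* y)) ->
  cseg (fun x => F (x +i* y)) a b.
Proof.
move=> h t /h[e he]; apply: (cderiv_path (g := fun x => x +i* y)) he.
by move=> s; exact: horizontal_dist.
Qed.

Lemma cseg_ver F c d x : (forall y, c <= y <= d -> holo F (x +i* y)) ->
  cseg (fun y => F (x +i* y)) c d.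
Proof.
move=> h t /h[e he]; apply: (cderiv_path (g := fun y => x +i* y)) he.
by move=> s; exact: vertical_dist.
Qed.

Lemma rint_splitx F a m b c d : a <= m -> m <= b -> c <= d ->
  (forall x y, a <= x <= b -> c <= y <= d ->
     [|| x == a, x == m, x == b, y == c | y == d] -> holo F (x +i* y)) ->
  rint F a b c d = rint F a m c d + rint F m b c d.
Proof.
move=> am mb cd h; have ab := le_trans am mb.
have hv x : a <= x <= b -> [|| x == a, x == m | x == b] ->
    cseg (fun y => F (x +i* y)) c d.
  move=> hx hx'; apply: cseg_ver => y hy; apply: h => //.
  by case/or3P: hx' => ->; rewrite ?orbT.
have [va vm vb] : [/\ cseg (fun y => F (a +i* y)) c d,
    cseg (fun y => F (m +i* y)) c d & cseg (fun y => F (b +i* y)) c d].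
  by split; apply: hv; rewrite ?lexx ?eqxx ?am ?mb ?ab /= ?orbT.
have [hc hd] : cseg (fun x => F (x +i* c)) a b /\ cseg (fun x => F (x +i* d)) a b.
  by split; apply: cseg_hor => x hx; apply: h; rewrite ?lexx ?ab ?cd ?eqxx /= ?orbT.
rewrite /rint (cint_split am mb); last exact: csegB.
rewrite (cintB vb va) (cintB vm va) (cintB vb vm).
ring.
Qed.

Lemma rint_splity F a b c m d : a <= b -> c <= m -> m <= d ->
  (forall x y, a <= x <= b -> c <= y <= d ->
     [|| y == c, y == m, y == d, x == a | x == b] -> holo F (x +i* y)) ->
  rint F a b c d = rint F a b c m + rint F a b m d.
Proof.
move=> ab cm md h; have cd := le_trans cm md.
have hh y : c <= y <= d -> [|| y == c, y == m | y == d] ->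
    cseg (fun x => F (x +i* y)) a b.
  move=> hy hy'; apply: cseg_hor => x hx; apply: h => //.
  by case/or3P: hy' => ->; rewrite ?orbT.
have [hc hm hd] : [/\ cseg (fun x => F (x +i* c)) a b,
    cseg (fun x => F (x +i* m)) a b & cseg (fun x => F (x +i* d)) a b].
  by split; apply: hh; rewrite ?lexx ?eqxx ?cm ?md ?cd /= ?orbT.
have [va vb] : cseg (fun y => F (a +i* y)) c d /\ cseg (fun y => F (b +i* y)) c d.
  by split; apply: cseg_ver => y hy; apply: h; rewrite ?lexx ?ab ?cd ?eqxx /= ?orbT.
rewrite /rint (cint_split cm md); last exact: csegB.
rewrite (cintB hc hd) (cintB hc hm) (cintB hm hd).
ring.
Qed.

(** An affine function has boundary integral 0 without any appeal to primitives: its differences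
    across opposite sides are the constants [k1] and [k2], and their contributions [k1 (b - a)] and
    [i k2 (d - c)] cancel. Only the deviation from the affine part is left. *)
Lemma rint_approx F a b c d (z0 F0 e : R[i]) eta : a <= b -> c <= d -> holo_rect F a b c d ->
  (forall x y, a <= x <= b -> c <= y <= d ->
     cabs (F (x +i* y) - F0 - e * (x +i* y - z0)) <= eta) ->
  cabs (rint F a b c d) <= 4 * eta * (b - a + (d - c)).
Proof.
move=> ab cd h he.
have hv x : a <= x <= b -> cseg (fun y => F (x +i* y)) c d.
  by move=> hx; apply: cseg_ver => y hy; exact: h.
have hh y : c <= y <= d -> cseg (fun x => F (x +i* y)) a b.
  by move=> hy; apply: cseg_hor => x hx; exact: h.
have [hc hd] : c <= c <= d /\ c <= d <= d by rewrite !lexx cd.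
have [ha hb] : a <= a <= b /\ a <= b <= b by rewrite !lexx ab.
have tri (u v : R[i]) : cabs u <= eta -> cabs v <= eta -> cabs (u - v) <= 2 * eta.
  by move=> hu hv'; rewrite (le_trans (cabsB _ _))//; lra.
pose k1 : R[i] := e * 'i%C * (c - d)%:C.
pose k2 : R[i] := e * (b - a)%:C.
have B1 : cabs (cint (fun x => F (x +i* c) - F (x +i* d)) a b - k1 * (b - a)%:C)
    <= 2 * (2 * eta) * (b - a).
  apply: cint_bound => //; first by apply: csegB; exact: hh.
  move=> x hx; have := tri _ _ (he x c hx hc) (he x d hx hd).
  congr (cabs _ <= _).
  have -> : k1 = e * ((x +i* c - z0) - (x +i* d - z0)).
    rewrite /k1 -mulrA; congr (_ * _); case: z0 {he tri} => p q; apply/eqP.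
    by rewrite eq_complex/=; apply/andP; split; apply/eqP; ring.
  ring.
have B2 : cabs (cint (fun y => F (b +i* y) - F (a +i* y)) c d - k2 * (d - c)%:C)
    <= 2 * (2 * eta) * (d - c).
  apply: cint_bound => //; first by apply: csegB; exact: hv.
  move=> x hx; have := tri _ _ (he b x hb hx) (he a x ha hx).
  congr (cabs _ <= _).
  have -> : k2 = e * ((b +i* x - z0) - (a +i* x - z0)).
    rewrite /k2; congr (_ * _); case: z0 {he tri} => p q; apply/eqP.
    by rewrite eq_complex/=; apply/andP; split; apply/eqP; ring.
  ring.
have -> : rint F a b c d =
   (cint (fun x => F (x +i* c) - F (x +i* d)) a b - k1 * (b - a)%:C) +
   'i%C * (cint (fun y => F (b +i* y) - F (a +i* y)) c d - k2 * (d - c)%:C).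
  rewrite /rint /k1 /k2 !rmorphB /=; ring.
rewrite (le_trans (cabsD _ _))// cabsM cabs_i mul1r.
by move: B1 B2; lra.
Qed.

(** If each quarter had less than a quarter of the total modulus, the triangle inequality would
    fail. The chosen quarter is recorded by its lower left corner alone, its size being determined
    by the depth of the bisection. *)
Lemma goursat_step F a b c d : a <= b -> c <= d -> holo_rect F a b c d ->
  exists p : R * R, [/\ a <= p.1, p.1 + (b - a) / 2 <= b, c <= p.2, p.2 + (d - c) / 2 <= d &
    cabs (rint F a b c d) <= 4 * cabs (rint F p.1 (p.1 + (b - a) / 2) p.2 (p.2 + (d - c) / 2))].
Proof.
move=> ab cd h.
pose m := a + (b - a) / 2; pose n := c + (d - c) / 2.
have [am mb] : a <= m /\ m <= b by rewrite /m; split; lra.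
have [cn nd] : c <= n /\ n <= d by rewrite /n; split; lra.
have mE : m + (b - a) / 2 = b by rewrite /m; lra.
have nE : n + (d - c) / 2 = d by rewrite /n; lra.
have E : rint F a b c d = (rint F a m c n + rint F a m n d) + (rint F m b c n + rint F m b n d).
  rewrite (rint_splitx am mb)//; last by move=> x y hx hy _; exact: h.
  rewrite (rint_splity am cn nd); last first.
    by move=> x y hx hy _; exact: (holo_rect_sub (lexx a) mb (lexx c) (lexx d) h).
  rewrite (rint_splity mb cn nd)// => x y hx hy _.
  exact: (holo_rect_sub am (lexx b) (lexx c) (lexx d) h).
apply: contrapT => /forallNP H.
have L1 := H (a, c); have L2 := H (a, n); have L3 := H (m, c); have L4 := H (m, n).
rewrite /= -/m -/n ?mE ?nE in L1 L2 L3 L4.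
have {}L1 : 4 * cabs (rint F a m c n) < cabs (rint F a b c d).
  by rewrite ltNge; apply/negP => ?; apply: L1.
have {}L2 : 4 * cabs (rint F a m n d) < cabs (rint F a b c d).
  by rewrite ltNge; apply/negP => ?; apply: L2.
have {}L3 : 4 * cabs (rint F m b c n) < cabs (rint F a b c d).
  by rewrite ltNge; apply/negP => ?; apply: L3.
have {}L4 : 4 * cabs (rint F m b n d) < cabs (rint F a b c d).
  by rewrite ltNge; apply/negP => ?; apply: L4.
have := cabsD (rint F a m c n + rint F a m n d) (rint F m b c n + rint F m b n d).
have := cabsD (rint F a m c n) (rint F a m n d).
have := cabsD (rint F m b c n) (rint F m b n d).
by rewrite -E; move: L1 L2 L3 L4; lra.
Qed.

Lemma nested_point (u : nat -> R) (v : nat -> R) : (forall n, u n <= u n.+1) ->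
  (forall n, v n.+1 <= v n) -> (forall n, u n <= v n) ->
  exists x, forall n, u n <= x <= v n.
Proof.
move=> hu hv huv.
have um : {homo u : m n / (m <= n)%N >-> m <= n}.
  by apply: homo_leq => //; exact: le_trans.
have vm : {homo v : m n / (m <= n)%N >-> n <= m}.
  by apply: (@homo_leq _ _ (fun x y => y <= x)) => // x y z h1 h2; exact: le_trans h1.
have uv m n : u m <= v n.
  rewrite (le_trans (um _ _ (leq_maxl m n)))// (le_trans (huv _))//.
  by apply: vm; exact: leq_maxr.
exists (sup (range u)) => n; apply/andP; split.
  apply: ub_le_sup; last by exists n.
  by exists (v 0%N) => _ [m _ <-].
by apply: ge_sup; [exists (u 0%N), 0%N|move=> _ [m _ <-]].
Qed.

Lemma goursat F a b c d : a <= b -> c <= d -> holo_rect F a b c d -> rint F a b c d = 0.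
Proof.
move=> ab cd h; apply/eqP; rewrite -cabs_eq0 eq_le cabs_ge0 andbT leNgt; apply/negP.
set K := cabs _ => K0.
pose w n := (b - a) / 2 ^+ n; pose g n := (d - c) / 2 ^+ n.
have wS n : w n / 2 = w n.+1 by rewrite /w exprSr invfM mulrA.
have gS n : g n / 2 = g n.+1 by rewrite /g exprSr invfM mulrA.
have w0 n : 0 <= w n by rewrite /w divr_ge0 ?exprn_ge0// subr_ge0.
have g0 n : 0 <= g n by rewrite /g divr_ge0 ?exprn_ge0// subr_ge0.
pose inv n (p : R * R) := [/\ a <= p.1, p.1 + w n <= b, c <= p.2, p.2 + g n <= d &
  K <= 4 ^+ n * cabs (rint F p.1 (p.1 + w n) p.2 (p.2 + g n))].
(* The invariant is a premise under the existential, so that [choice] yields a total function; off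
   the invariant any point will do. *)
have step (np : nat * (R * R)) : exists p' : R * R, inv np.1 np.2 ->
   [/\ inv np.1.+1 p', np.2.1 <= p'.1, p'.1 + w np.1.+1 <= np.2.1 + w np.1,
      np.2.2 <= p'.2 & p'.2 + g np.1.+1 <= np.2.2 + g np.1].
  case: np => n p; have [[/= i1 i2 i3 i4 i5]|hn] := pselect (inv n p); last by exists p => /hn.
  have := @goursat_step F p.1 (p.1 + w n) p.2 (p.2 + g n).
  have wE : p.1 + w n - p.1 = w n by rewrite addrC addKr.
  have gE : p.2 + g n - p.2 = g n by rewrite addrC addKr.
  rewrite wE gE wS gS !lerDl => /(_ (w0 _) (g0 _)) [].
    exact: holo_rect_sub h.
  move=> p' [j1 j2 j3 j4 j5]; exists p' => _; split => //; split => //.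
  - exact: le_trans j1.
  - exact: le_trans i2.
  - exact: le_trans j3.
  - exact: le_trans i4.
  - rewrite (le_trans i5)// exprSr -mulrA ler_wpM2l// exprn_ge0//.
have [f hf] := choice step.
pose s := fix s n := if n is m.+1 then f (m, s m) else (a, c).
have is_ n : inv n (s n).
  elim: n => [|n /(hf (n, _))[]//].
  by split; rewrite /w /g //= ?expr0 ?divr1 ?mul1r ?subrKC //.
have sS n := hf (n, s n) (is_ n).
have [x0 hx0] : exists x, forall n, (s n).1 <= x <= (s n).1 + w n.
  by apply: nested_point => n; [by have [] := sS n|by have [] := sS n|by rewrite lerDl].
have [y0 hy0] : exists y, forall n, (s n).2 <= y <= (s n).2 + g n.
  by apply: nested_point => n; [by have [] := sS n|by have [] := sS n|by rewrite lerDl].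
have [||e he] := h x0 y0.
- by have := hx0 0%N; rewrite /w /= expr0 divr1 subrKC.
- by have := hy0 0%N; rewrite /g /= expr0 divr1 subrKC.
(* With [L = b - a + (d - c)], the rectangle of depth [n] has sides adding up to [L / 2^n], so a
   differentiability error [eps] bounds [K] by [4^n * 4 * eps * (L / 2^n)^2 = 4 * eps * L^2]. For
   [eps = K / (8 S)] this is below [K / 2]; the added 1 keeps [S] positive when [L = 0]. *)
pose S := (b - a + (d - c)) ^+ 2 + 1.
have S0 : 0 < S by rewrite /S ltr_wpDl// sqr_ge0.
have eps0 : 0 < K / (8 * S) by rewrite divr_gt0// mulr_gt0.
have [del del0 hdel] := he _ eps0.
have [n hn] : exists n, (b - a + (d - c)) / 2 ^+ n < del.
  have := @cvg_geometric R (b - a + (d - c)) (2^-1).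
  have -> : `|2^-1 : R| < 1 by rewrite ger0_norm ?invr_ge0// invf_lt1// ltr1n.
  move=> /(_ isT)/cvgrPdist_lt/(_ _ del0)[N _ /(_ N (leqnn N))].
  rewrite sub0r normrN /= => hN; exists N; rewrite (le_lt_trans (ler_norm _))//.
  by rewrite -exprVn.
have hsum : w n + g n = (b - a + (d - c)) / 2 ^+ n by rewrite /w /g -mulrDl.
have [i1 i2 i3 i4 i5] := is_ n.
have /= := @rint_approx F (s n).1 ((s n).1 + w n) (s n).2 ((s n).2 + g n) (x0 +i* y0)
  (F (x0 +i* y0)) e (K / (8 * S) * (w n + g n)).
rewrite !lerDl => /(_ (w0 n) (g0 n) (holo_rect_sub i1 i2 i3 i4 h)) happ.
have /happ : forall x y, (s n).1 <= x <= (s n).1 + w n -> (s n).2 <= y <= (s n).2 + g n ->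
    cabs (F (x +i* y) - F (x0 +i* y0) - e * (x +i* y - (x0 +i* y0))) <= K / (8 * S) * (w n + g n).
  move=> x y hx hy.
  have dz : cabs (x +i* y - (x0 +i* y0)) <= w n + g n.
    rewrite (le_trans (cabs_le _))//=; apply: lerD.
      have := hx0 n; rewrite ler_norml; move: hx; lra.
    have := hy0 n; rewrite ler_norml; move: hy; lra.
  apply: (le_trans (hdel _ _)); first by rewrite (le_lt_trans dz)// hsum.
  by rewrite ler_wpM2l// ltW.
rewrite (addrC (s n).1) addrK (addrC (s n).2) addrK hsum.
rewrite (addrC _ (s n).1) (addrC _ (s n).2).
set Q := cabs _ in i5 * => hQ.
have E4 : (4 : R) ^+ n = 2 ^+ n * 2 ^+ n by rewrite -exprMn; congr (_ ^+ _); ring.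
have P0 : 0 < (2 : R) ^+ n by exact: exprn_gt0.
have : K <= 4 * (K / (8 * S)) * (b - a + (d - c)) ^+ 2.
  apply: (le_trans i5); rewrite E4.
  apply: (@le_trans _ _ (2 ^+ n * 2 ^+ n * (4 * (K / (8 * S) *
     ((b - a + (d - c)) / 2 ^+ n)) * ((b - a + (d - c)) / 2 ^+ n)))).
    by rewrite ler_wpM2l// mulr_ge0// ltW.
  rewrite le_eqVlt; apply/orP; left; apply/eqP; field.
  by rewrite !gt_eqF.
have -> : 4 * (K / (8 * S)) * (b - a + (d - c)) ^+ 2 = K * ((S - 1) / (2 * S)).
  rewrite /S addrK; field; exact: lt0r_neq0.
rewrite leNgt => /negP; apply.
rewrite -[ltRHS]mulr1 ltr_pM2l// ltr_pdivrMr ?mulr_gt0// mul1r; lra.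
Qed.

End Goursat.

(** * Residues at simple poles *)

Section Residue.
Variable R : realType.
Notation mu := (@lebesgue_measure R).
Implicit Types (F : R[i] -> R[i]) (a b c d p q s x y : R).

(** The integrand is, up to a factor [i] on the horizontal sides, the difference of [1 / (z - z0)]
    across opposite sides of a square centred at [z0]. The arctangent runs from [- pi / 4] to
    [pi / 4], so each of the two pairs of sides supplies half of [2 pi i]. *)
Lemma Rint_poisson p s : 0 < s ->
  \int[mu]_(x in `[p - s, p + s]) (2 * s / ((x - p) ^+ 2 + s ^+ 2)) = pi.
Proof.
move=> s0; rewrite /Rintegral.
have ab : p - s < p + s by lra.
pose f x : R := 2 * s / ((x - p) ^+ 2 + s ^+ 2).
pose G x : R := 2 * atan ((x - p) / s).
have den x : (x - p) ^+ 2 + s ^+ 2 != 0.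
  by rewrite gt_eqF// ltr_wpDl ?sqr_ge0// exprn_gt0.
have dG x : is_derive x (1 : R) G (f x).
  have h1 : is_derive x (1 : R) (fun x => (x - p) / s) s^-1.
    apply: is_derive_eq; rewrite /GRing.scale/= !mulr0 !add0r ?subr0 ?addr0 mulr1//.
  have h2 := is_derive1_comp (f := atan) (g := fun x => (x - p) / s) (is_derive1_atan _) h1.
  apply: is_derive_eq.
  rewrite /f /GRing.scale/=; field.
  by rewrite den gt_eqF//=; have := den x; lra.
have cG x : {for x, continuous G}.
  apply: differentiable_continuous; apply/derivable1_diffP.
  by have [] := dG x.
have cf x : {for x, continuous f}.
  apply: continuousM; first exact: cst_continuous.
  apply: continuousV; first exact: den.
  apply: continuousD; last exact: cst_continuous.
  apply: (@continuous_comp _ _ _ (fun x => x - p) (fun x => x ^+ 2)); last exact: exprn_continuous.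
  by apply: continuousB => //; exact: cst_continuous.
rewrite (@continuous_FTC2 _ f G _ _ ab).
- rewrite -EFinB /= /G addrAC subrr add0r (addrAC p) subrr add0r mulNr divff ?gt_eqF//.
  by rewrite atanN atan1; field.
- by apply: continuous_subspaceT => x; exact: cf.
- split.
  + by move=> x _; have [] := dG x.
  + exact: cvg_at_right_filter (cG _).
  + exact: cvg_at_left_filter (cG _).
- by move=> x _; rewrite derive1E; have [_] := dG x.
Qed.

Lemma rint_pole p q s : 0 < s ->
  rint (fun z => (z - (p +i* q))^-1) (p - s) (p + s) (q - s) (q + s) = 2 * pi%:C * 'i%C.
Proof.
move=> s0; rewrite /rint /cint.
have nz (x : R) : x ^+ 2 + s ^+ 2 != 0.
  by rewrite gt_eqF// ltr_wpDl ?sqr_ge0// exprn_gt0.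
have E1 x : (x +i* (q - s) - (p +i* q))^-1 - (x +i* (q + s) - (p +i* q))^-1 =
    0 +i* (2 * s / ((x - p) ^+ 2 + s ^+ 2)).
  have -> : x +i* (q - s) - (p +i* q) = (x - p) +i* (- s).
    by apply/eqP; rewrite eq_complex/=; apply/andP; split; apply/eqP; ring.
  have -> : x +i* (q + s) - (p +i* q) = (x - p) +i* s.
    by apply/eqP; rewrite eq_complex/=; apply/andP; split; apply/eqP; ring.
  have := nz (x - p); set u := x - p => hu.
  by apply/eqP; rewrite eq_complex/= sqrrN; apply/andP; split; apply/eqP; field.
have E2 y : ((p + s) +i* y - (p +i* q))^-1 - ((p - s) +i* y - (p +i* q))^-1 =
    (2 * s / ((y - q) ^+ 2 + s ^+ 2)) +i* 0.
  have -> : (p + s) +i* y - (p +i* q) = s +i* (y - q).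
    by apply/eqP; rewrite eq_complex/=; apply/andP; split; apply/eqP; ring.
  have -> : (p - s) +i* y - (p +i* q) = (- s) +i* (y - q).
    by apply/eqP; rewrite eq_complex/=; apply/andP; split; apply/eqP; ring.
  have := nz (y - q); set u := y - q => hu.
  have hu' : s ^+ 2 + u ^+ 2 != 0 by rewrite addrC.
  by apply/eqP; rewrite eq_complex/= sqrrN; apply/andP; split; apply/eqP; field; rewrite ?hu ?hu'.
rewrite (funext (fun x => congr1 (@complex.Re R) (E1 x))) (funext (fun x => congr1 (@complex.Im R) (E1 x))).
rewrite (funext (fun x => congr1 (@complex.Re R) (E2 x))) (funext (fun x => congr1 (@complex.Im R) (E2 x))) /=.
rewrite !Rint_poisson// !Rintegral_cst//= !mul0r.
by apply/eqP; rewrite eq_complex/=; apply/andP; split; apply/eqP; ring.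
Qed.

Definition holo_off F (z0 : R[i]) a b c d :=
  forall x y, a <= x <= b -> c <= y <= d -> x +i* y != z0 -> holo F (x +i* y).

Lemma neqcl x y p q : x != p -> x +i* y != p +i* q.
Proof. by move=> /eqP xp; apply/eqP => -[]. Qed.

Lemma neqcr x y p q : y != q -> x +i* y != p +i* q.
Proof. by move=> /eqP xp; apply/eqP => -[]. Qed.

(** Two vertical cuts and two cuts of the middle column isolate the square; the four rectangles cut
    off contain no singularity, and Goursat's theorem removes them. *)
Lemma rint_shrink F p q a b c d s : 0 < s ->
  a < p - s -> p + s < b -> c < q - s -> q + s < d ->
  holo_off F (p +i* q) a b c d ->
  rint F a b c d = rint F (p - s) (p + s) (q - s) (q + s).
Proof.
move=> s0 h1 h2 h3 h4 h.
have cd : c <= d by lra.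
rewrite (@rint_splitx _ F a (p - s)) ?(ltW h1)//; [|lra|]; last first.
  move=> x y hx hy hxy; apply: h => //.
  case/or4P: hxy => [/eqP->|/eqP->|/eqP->|/orP[]/eqP->];
    by [apply: neqcl; apply/eqP => ?; lra|apply: neqcr; apply/eqP => ?; lra].
rewrite (@rint_splitx _ F (p - s) (p + s)) ?(ltW h2)//; [|lra|]; last first.
  move=> x y hx hy hxy; apply: h => //; first by move: hx; lra.
  case/or4P: hxy => [/eqP->|/eqP->|/eqP->|/orP[]/eqP->];
    by [apply: neqcl; apply/eqP => ?; lra|apply: neqcr; apply/eqP => ?; lra].
rewrite (@rint_splity _ F (p - s) (p + s) c (q - s)) ?(ltW h3)//; [|lra|lra|]; last first.
  move=> x y hx hy hxy; apply: h => //; first by move: hx; lra.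
  case/or4P: hxy => [/eqP->|/eqP->|/eqP->|/orP[]/eqP->];
    by [apply: neqcr; apply/eqP => ?; lra|apply: neqcl; apply/eqP => ?; lra].
rewrite (@rint_splity _ F (p - s) (p + s) (q - s) (q + s)) ?(ltW h4)//; [|lra|lra|]; last first.
  move=> x y hx hy hxy; apply: h => //; [by move: hx; lra|by move: hy; lra|].
  case/or4P: hxy => [/eqP->|/eqP->|/eqP->|/orP[]/eqP->];
    by [apply: neqcr; apply/eqP => ?; lra|apply: neqcl; apply/eqP => ?; lra].
rewrite (@goursat _ F a) ?(ltW h1)//; last first.
  move=> x y hx hy; apply: h; [by move: hx; lra|by []|].
  by apply: neqcl; rewrite lt_eqF//; move: hx; lra.
rewrite (@goursat _ F (p + s)) ?(ltW h2)//; last first.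
  move=> x y hx hy; apply: h; [by move: hx; lra|by []|].
  by apply: neqcl; rewrite gt_eqF//; move: hx; lra.
rewrite (@goursat _ F _ _ c) ?(ltW h3)//; [|lra|]; last first.
  move=> x y hx hy; apply: h; [by move: hx; lra|by move: hy; lra|].
  by apply: neqcr; rewrite lt_eqF//; move: hy; lra.
rewrite (@goursat _ F _ _ (q + s)) ?(ltW h4)//; [|lra|]; last first.
  move=> x y hx hy; apply: h; [by move: hx; lra|by move: hy; lra|].
  by apply: neqcr; rewrite gt_eqF//; move: hy; lra.
by rewrite !add0r !addr0.
Qed.

Lemma rint_subZ F G k a b c d : a <= b -> c <= d ->
  (forall x y, a <= x <= b -> c <= y <= d ->
     [|| x == a, x == b, y == c | y == d] -> holo F (x +i* y) /\ holo G (x +i* y)) ->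
  rint (fun z => F z - k * G z) a b c d = rint F a b c d - k * rint G a b c d.
Proof.
move=> ab cd h.
have hh H : (forall x y, a <= x <= b -> c <= y <= d ->
     [|| x == a, x == b, y == c | y == d] -> holo H (x +i* y)) ->
   cseg (fun x => H (x +i* c) - H (x +i* d)) a b /\
   cseg (fun y => H (b +i* y) - H (a +i* y)) c d.
  move=> hH; split; apply: csegB.
  - by apply: cseg_hor => x hx; apply: hH; rewrite ?lexx ?cd ?eqxx ?orbT.
  - by apply: cseg_hor => x hx; apply: hH; rewrite ?lexx ?cd ?eqxx ?orbT.
  - by apply: cseg_ver => x hx; apply: hH; rewrite ?lexx ?ab ?eqxx ?orbT.
  - by apply: cseg_ver => x hx; apply: hH; rewrite ?lexx ?ab ?eqxx ?orbT.
have [F1 F2] := hh F (fun x y hx hy hxy => (h x y hx hy hxy).1).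
have [G1 G2] := hh G (fun x y hx hy hxy => (h x y hx hy hxy).2).
rewrite /rint.
have -> : (fun x => F (x +i* c) - k * G (x +i* c) - (F (x +i* d) - k * G (x +i* d))) =
  (fun x => (F (x +i* c) - F (x +i* d)) - k * (G (x +i* c) - G (x +i* d))).
  by apply/funext => x; ring.
have -> : (fun y => F (b +i* y) - k * G (b +i* y) - (F (a +i* y) - k * G (a +i* y))) =
  (fun y => (F (b +i* y) - F (a +i* y)) - k * (G (b +i* y) - G (a +i* y))).
  by apply/funext => x; ring.
rewrite (cintB F1 (@csegZ _ k _ _ _ G1)) (cintB F2 (@csegZ _ k _ _ _ G2)).
rewrite (cintZ k G1) (cintZ k G2).
ring.
Qed.

Lemma rint_bound F a b c d M : a <= b -> c <= d ->
  (forall x y, a <= x <= b -> c <= y <= d ->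
     [|| x == a, x == b, y == c | y == d] -> holo F (x +i* y) /\ cabs (F (x +i* y)) <= M) ->
  cabs (rint F a b c d) <= 4 * M * (b - a + (d - c)).
Proof.
move=> ab cd h.
have B1 : cabs (cint (fun x => F (x +i* c) - F (x +i* d)) a b - 0 * (b - a)%:C) <= 2 * (2 * M) * (b - a).
  apply: cint_bound => //.
    by apply: csegB; apply: cseg_hor => x hx; apply h; rewrite ?lexx ?cd ?eqxx ?orbT.
  move=> x hx; rewrite subr0 (le_trans (cabsB _ _))//.
  have [||_] := h x c hx; rewrite ?lexx ?cd ?eqxx ?orbT//.
  have [||_] := h x d hx; rewrite ?lexx ?cd ?eqxx ?orbT//.
  by lra.
have B2 : cabs (cint (fun y => F (b +i* y) - F (a +i* y)) c d - 0 * (d - c)%:C) <= 2 * (2 * M) * (d - c).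
  apply: cint_bound => //.
    by apply: csegB; apply: cseg_ver => x hx; apply h; rewrite ?lexx ?ab ?eqxx ?orbT.
  move=> x hx; rewrite subr0 (le_trans (cabsB _ _))//.
  have [||_] := h a x _ hx; rewrite ?lexx ?ab ?eqxx ?orbT//.
  have [||_] := h b x _ hx; rewrite ?lexx ?ab ?eqxx ?orbT//.
  by lra.
rewrite mul0r subr0 in B1; rewrite mul0r subr0 in B2.
rewrite /rint (le_trans (cabsD _ _))// cabsM cabs_i mul1r.
by move: B1 B2; lra.
Qed.

(** A pole of order at most one with residue [A], described by the limit of [(w - z0) F w] instead
    of a Laurent expansion; [A = 0] is allowed. *)
Definition pole F (z0 A : R[i]) := forall e : R, 0 < e -> exists2 del : R, 0 < del &
  forall w, w != z0 -> cabs (w - z0) < del -> cabs ((w - z0) * F w - A) <= e.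

(** The integral does not change when the rectangle shrinks to a small square around the pole. There
    [F - A / (z - z0)] is small compared with [1 / s], while the perimeter is [8 s], so only the
    integral of [A / (z - z0)] survives. *)
Lemma residue F p q a b c d A : a < p -> p < b -> c < q -> q < d ->
  holo_off F (p +i* q) a b c d -> pole F (p +i* q) A ->
  rint F a b c d = 2 * pi%:C * 'i%C * A.
Proof.
move=> ap pb cq qd h hA.
apply/eqP; rewrite -subr_eq0 -cabs_eq0 eq_le cabs_ge0 andbT.
apply/ler_addgt0Pr => e e0; rewrite add0r.
(* [rint_bound] on a square of half-side [s] with [M = e / (16 s)] gives [4 * M * (4 s) = e]. *)
have [del del0 hdel] := hA (e / 16) (divr_gt0 e0 (ltr0n _ 16)).
(* The bound [del / 4] puts the square, where [|z - z0| <= 2 s], inside the disc of radius [del];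
   the other bounds keep it strictly inside the rectangle. *)
pose s := Num.min (del / 4) (Num.min (Num.min ((p - a) / 2) ((b - p) / 2))
   (Num.min ((q - c) / 2) ((d - q) / 2))).
have s0 : 0 < s by rewrite /s !lt_min; apply/and3P; split => //; [lra|apply/andP; split; lra|apply/andP; split; lra].
have : s <= s by []. rewrite {2}/s !le_min => /andP[s1 /andP[/andP[s2 s3] /andP[s4 s5]]].
have hb : holo_off F (p +i* q) (p - s) (p + s) (q - s) (q + s).
  by move=> x y hx hy; apply: h; [move: hx; lra|move: hy; lra].
rewrite (rint_shrink (s := s) _ _ _ _ _ h)//; [|lra..].
have bdry x y : [|| x == p - s, x == p + s, y == q - s | y == q + s] -> x +i* y != p +i* q.
  by case/or4P => /eqP->; [apply: neqcl|apply: neqcl|apply: neqcr|apply: neqcr];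
    apply/eqP => ?; lra.
have hk x y : x +i* y != p +i* q -> holo (fun z => (z - (p +i* q))^-1) (x +i* y).
  move=> hxy; eexists; apply: cderivV; first by rewrite subr_eq0.
  by apply: cderivB; [exact: cderiv_id|exact: cderiv_cst].
have -> : 2 * pi%:C * 'i%C * A = A * (2 * pi%:C * 'i%C) by ring.
rewrite -(rint_pole p q s0) -rint_subZ//; [|lra|lra|]; last first.
  by move=> x y hx hy /bdry hxy; split; [exact: hb|exact: hk].
apply: (le_trans (@rint_bound _ _ _ _ _ (e / (16 * s)) _ _ _)); [lra|lra| |].
  move=> x y hx hy hxy; have hz := bdry _ _ hxy; split.
    have [d1 hd1] := hb x y hx hy hz; have [d2 hd2] := hk x y hz.
    by eexists; apply: cderivB; [exact: hd1|apply: cderivZ; exact: hd2].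
  set z := x +i* y - (p +i* q).
  have z0 : z != 0 by rewrite /z subr_eq0.
  have -> : F (x +i* y) - A * z^-1 = (z * F (x +i* y) - A) / z by field.
  rewrite cabsM cabsV ler_pdivrMr ?cabs_gt0//.
  have zd : cabs z < del.
    rewrite (le_lt_trans (cabs_le _))//=.
    have H1 : `|x - p| <= s by rewrite ler_norml; move: hx; lra.
    have H2 : `|y - q| <= s by rewrite ler_norml; move: hy; lra.
    by move: H1 H2; lra.
  apply: (le_trans (hdel _ hz zd)).
  have sz : s <= cabs z.
    case/or4P: hxy => /eqP E.
    - by rewrite (le_trans _ (Re_le_cabs _))//= E (_ : p - s - p = - s) ?normrN ?gtr0_norm//; ring.
    - by rewrite (le_trans _ (Re_le_cabs _))//= E (_ : p + s - p = s) ?gtr0_norm//; ring.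
    - by rewrite (le_trans _ (Im_le_cabs _))//= E (_ : q - s - q = - s) ?normrN ?gtr0_norm//; ring.
    - by rewrite (le_trans _ (Im_le_cabs _))//= E (_ : q + s - q = s) ?gtr0_norm//; ring.
  have -> : e / (16 * s) * cabs z = e / 16 * (cabs z / s) by field; exact: lt0r_neq0.
  by rewrite ler_peMr ?divr_ge0 ?(ltW e0)// ler_pdivlMr// mul1r.
rewrite le_eqVlt; apply/orP; left; apply/eqP; field; exact: lt0r_neq0.
Qed.

End Residue.

(** * Complex exponential, sine and cosine *)

Section Climit.
Variable R : realType.
Local Notation C := (R[i])^o.
Implicit Types (F G : R[i] -> R[i]) (z w l : R[i]).

Definition climit F z l := forall e : R, 0 < e -> exists2 del : R, 0 < del &
  forall w, w != z -> cabs (w - z) < del -> cabs (F w - l) <= e.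

Lemma climitP F z l : climit F z l <-> (F : C -> C) @ (z : C)^' --> (l : C).
Proof.
split=> [h|/cvgrPdist_le h].
  apply/cvgrPdist_le => e e0.
  have [er e0r eE] : exists2 er : R, 0 < er & e = er%:C.
    exists (complex.Re e); last by rewrite RRe_real// gtr0_real.
    by move: e0; rewrite ltcE => /andP[_].
  subst e; have [del d0 hd] := h _ e0r.
  rewrite /prop_near1 /nbhs /= /dnbhs /within /=; apply/nbhs_ballP.
  exists del%:C => /=; first by rewrite ltcR.
  move=> w; rewrite /ball /= normcabs ltcR => hw wz.
  by rewrite normcabs lecR cabsC hd// cabsC.
move=> e e0; have : (0 : C) < e%:C by rewrite ltcR.
move=> /h; rewrite /prop_near1 /nbhs /= /dnbhs /within /= => /nbhs_ballP[r r0 hr].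
have [rr r0r rE] : exists2 er : R, 0 < er & r = er%:C.
  exists (complex.Re r); last by rewrite RRe_real// gtr0_real.
  by move: r0; rewrite /= ltcE => /andP[_].
subst r. exists rr => // w wz hw.
rewrite cabsC in hw.
have := hr w; rewrite /ball /= normcabs ltcR => /(_ hw wz).
by rewrite normcabs lecR [leLHS]cabsC.
Qed.

Lemma climitM F G z l m : climit F z l -> climit G z m ->
  climit (fun w => F w * G w) z (l * m).
Proof. by move=> /climitP hF /climitP hG; apply/climitP; exact: (cvgM hF hG). Qed.

Lemma climitV F z l : l != 0 -> climit F z l -> climit (fun w => (F w)^-1) z l^-1.
Proof. by move=> l0 /climitP hF; apply/climitP; exact: cvgV. Qed.

Lemma climit_ext F G z l : (forall w, w != z -> F w = G w) -> climit F z l -> climit G z l.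
Proof.
move=> FG h e /h[del d0 hd]; exists del => // w wz hw.
by rewrite -FG//; exact: hd.
Qed.

Lemma climit_holo F z : holo F z -> climit F z (F z).
Proof.
move=> [d /cderiv_continuous h] e /h[del d0 hd]; exists del => // w _ hw.
exact/ltW/hd.
Qed.

Lemma climit_slope F z d : cderiv F z d -> climit (fun w => (F w - F z) / (w - z)) z d.
Proof.
move=> h e /h[del d0 hd]; exists del => // w wz /hd.
have wz0 : w - z != 0 by rewrite subr_eq0.
have -> : (F w - F z) / (w - z) - d = (F w - F z - d * (w - z)) / (w - z) by field.
by rewrite cabsM cabsV ler_pdivrMr ?cabs_gt0.
Qed.

Lemma slope_cderiv F z d : climit (fun w => (F w - F z) / (w - z)) z d -> cderiv F z d.
Proof.
move=> h e /h[del d0 hd]; exists del => // w hw.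
have [->|wz] := eqVneq w z; first by rewrite !subrr mulr0 subr0 cabs0 mulr0.
have wz0 : w - z != 0 by rewrite subr_eq0.
have := hd w wz hw.
have -> : (F w - F z) / (w - z) - d = (F w - F z - d * (w - z)) / (w - z) by field.
by rewrite cabsM cabsV ler_pdivrMr ?cabs_gt0.
Qed.

End Climit.

Section Cexp.
Variable R : realType.
Implicit Types (z w : R[i]) (x y : R).

(** Defined through [polar] so that the denominators of [polar_quotient] in logarithmic coordinates
    are, by conversion, differences of exponentials. *)
Definition cexp z : R[i] := polar (expR (complex.Re z), complex.Im z).

Lemma cexpE x y : cexp (x +i* y) = (expR x * cos y) +i* (expR x * sin y).
Proof.
rewrite /cexp /polar /=; apply/eqP.
by rewrite eq_complex/=; apply/andP; split; apply/eqP; ring.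
Qed.

Lemma cexp0 : cexp 0 = 1.
Proof. by rewrite cexpE expR0 cos0 sin0 mulr1 mulr0. Qed.

Lemma cexpD z w : cexp (z + w) = cexp z * cexp w.
Proof.
case: z w => [a b] [c d]; rewrite !cexpE /= expRD cosD sinD.
by apply/eqP; rewrite eq_complex/=; apply/andP; split; apply/eqP; ring.
Qed.

Lemma cabs_cexp z : cabs (cexp z) = expR (complex.Re z).
Proof.
case: z => x y; rewrite cabsE cexpE /= !exprMn -mulrDr cos2Dsin2 mulr1.
by rewrite sqrtr_sqr ger0_norm// expR_ge0.
Qed.

Lemma cexp_neq0 z : cexp z != 0.
Proof. by rewrite -cabs_gt0 cabs_cexp expR_gt0. Qed.

Lemma real_deriv_bound (f : R -> R) x d : is_derive x (1 : R) f d ->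
  forall e, 0 < e -> exists2 del, 0 < del &
    forall h, `|h| < del -> `|f (h + x) - f x - d * h| <= e * `|h|.
Proof.
move=> [h1 h2] e e0.
have : (fun h => h^-1 *: ((f \o shift x) (h *: (1 : R)) - f x)) @ 0^' --> d.
  by rewrite -h2; exact: h1.
move=> /cvgrPdist_le/(_ e e0).
rewrite /prop_near1 /nbhs /= /dnbhs /within /= => /nbhs_ballP[r r0 hr].
exists r => // h hh.
have [->|h0] := eqVneq h 0; first by rewrite add0r subrr mulr0 subr0 normr0 mulr0.
have := hr h; rewrite /ball /= sub0r normrN => /(_ hh h0).
rewrite -(@ler_pM2r _ `|h|) ?normr_gt0// -normrM distrC => hb.
apply: le_trans hb; rewrite le_eqVlt; apply/orP; left; apply/eqP; rewrite -normrN.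
rewrite -[in LHS]normrN; congr `| _ |; rewrite /= /GRing.scale /= mulr1; field.
by [].
Qed.

Lemma cderiv_cexp0 : cderiv cexp 0 1.
Proof.
move=> e e0.
(* The errors below add up to [1 + 3 + 3 + 2 = 9] multiples of [e1 * N]; [e1 <= 1] gives
   [expR a <= 3]. *)
have [e1 e10 [e1e e11]] : exists2 e1 : R, 0 < e1 & e1 <= e / 9 /\ e1 <= 1.
  exists (Num.min (e / 9) 1); first by rewrite lt_min ltr01 andbT divr_gt0.
  by rewrite !ge_min !lexx ?orbT.
have [d1 d10 h1] := real_deriv_bound (is_derive_expR 0) e10.
have [d2 d20 h2] := real_deriv_bound (is_derive_cos 0) e10.
have [d3 d30 h3] := real_deriv_bound (is_derive_sin 0) e10.
exists (Num.min (Num.min d1 d2) (Num.min d3 e1)).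
  by rewrite !lt_min d10 d20 d30 e10.
case=> a b; rewrite subr0 !lt_min => /andP[/andP[w1 w2] /andP[w3 w4]].
have aN : `|a| <= cabs (a +i* b) := Re_le_cabs (a +i* b).
have bN : `|b| <= cabs (a +i* b) := Im_le_cabs (a +i* b).
set N := cabs (a +i* b) in w1 w2 w3 w4 aN bN *.
have {h1} := h1 a (le_lt_trans aN w1).
have {h2} := h2 b (le_lt_trans bN w2).
have {h3} := h3 b (le_lt_trans bN w3).
rewrite !addr0 expR0 cos0 sin0 oppr0 mul0r subr0 !mul1r => hs hc he.
have a1 : `|a| <= e1 by rewrite (le_trans aN)// ltW.
have E1 : `|expR a - 1| <= 2 * `|a|.
  have := ler_normD (expR a - 1 - a) a; rewrite subrK => /le_trans; apply.
  have : e1 * `|a| <= 1 * `|a| by rewrite ler_wpM2r.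
  by move: he; lra.
have E3 : expR a <= 3.
  have := ler_norm (expR a - 1); move: E1 a1 e11; lra.
have ea0 := expR_ge0 a.
rewrite cexp0 (_ : cexp _ - 1 - _ = (expR a * cos b - 1 - a) +i* (expR a * sin b - b)); last first.
  by rewrite cexpE; apply/eqP; rewrite eq_complex/=; apply/andP; split; apply/eqP; ring.
rewrite (le_trans (cabs_le _))//=.
have B1 : `|expR a * cos b - 1 - a| <= e1 * `|a| + 3 * (e1 * `|b|).
  have -> : expR a * cos b - 1 - a = (expR a - 1 - a) + expR a * (cos b - 1) by ring.
  rewrite (le_trans (ler_normD _ _))// lerD// normrM (ger0_norm ea0).
  by rewrite ler_pM.
have B2 : `|expR a * sin b - b| <= 3 * (e1 * `|b|) + 2 * e1 * `|b|.
  have -> : expR a * sin b - b = expR a * (sin b - b) + (expR a - 1) * b by ring.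
  apply: (le_trans (ler_normD _ _)); apply: lerD; rewrite normrM.
    by rewrite (ger0_norm ea0) ler_pM//; rewrite addr0 in hs.
  by rewrite ler_wpM2r// (le_trans E1)//; lra.
have N0 : 0 <= N := cabs_ge0 _.
have T1 : e1 * `|a| <= e1 * N by rewrite ler_wpM2l// ltW.
have T2 : e1 * `|b| <= e1 * N by rewrite ler_wpM2l// ltW.
have T3 : e1 * N <= e / 9 * N by rewrite ler_wpM2r.
by move: B1 B2; lra.
Qed.

Lemma cderiv_cexp z : cderiv cexp z (cexp z).
Proof.
have := @cderiv_affine R cexp 1 (- z) z 1.
rewrite mul1r subrr => /(_ cderiv_cexp0) /(cderivZ (cexp z)).
rewrite !mulr1; apply: cderiv_ext => w.
by rewrite -cexpD mul1r addrC subrK.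
Qed.

Definition ccos z : R[i] := 2^-1 * (cexp ('i%C * z) + cexp (- 'i%C * z)).

Definition csin z : R[i] := (2 * 'i%C)^-1 * (cexp ('i%C * z) - cexp (- 'i%C * z)).

Lemma ciM x y : 'i%C * (x +i* y) = (- y) +i* x :> R[i].
Proof. by apply/eqP; rewrite eq_complex/=; apply/andP; split; apply/eqP; ring. Qed.

Lemma ccosE x y : ccos (x +i* y) =
  (cos x * ((expR y + expR (- y)) / 2)) +i* (sin x * ((expR (- y) - expR y) / 2)).
Proof.
have h2 : (2 : R[i])^-1 = (2^-1 : R)%:C by rewrite fmorphV /= rmorph_nat.
rewrite /ccos mulNr ciM h2 (_ : - (- y +i* x) = y +i* (- x)); last first.
  by apply/eqP; rewrite eq_complex/= opprK !eqxx.
rewrite !cexpE cosN sinN.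
by apply/eqP; rewrite eq_complex/=; apply/andP; split; apply/eqP; field.
Qed.

Lemma csinE x : csin x%:C = (sin x)%:C.
Proof.
have -> : csin x%:C = (2 * 'i%C)^-1 * (2 * 'i%C * (sin x)%:C).
  rewrite /csin mulNr; congr (_ * _).
  rewrite ciM (_ : - (- 0 +i* x) = 0 +i* (- x)); last first.
    by apply/eqP; rewrite eq_complex/= !oppr0 !eqxx.
  rewrite oppr0 !cexpE cosN sinN expR0 !mul1r.
  by apply/eqP; rewrite eq_complex/=; apply/andP; split; apply/eqP; ring.
by rewrite mulKf// mulf_neq0 ?pnatr_eq0// -cabs_gt0 cabs_i.
Qed.

Lemma cabs_csin_le x y : cabs (csin (x +i* y)) <= expR `|y|.
Proof.
have h2 : cabs (2 * 'i%C : R[i]) = 2.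
  by rewrite cabsM cabs_i mulr1 -(rmorph_nat (real_complex R)) cabsR ger0_norm.
rewrite /csin cabsM cabsV h2 ler_pdivrMl// (le_trans (cabsB _ _))//.
rewrite !cabs_cexp mulNr ciM /= opprK.
have h1 := ler_norm y; have h3 := ler_norm (- y); rewrite normrN in h3.
by rewrite mulr_natl mulr2n lerD// ler_expR.
Qed.

Lemma cderiv_ccos z : cderiv ccos z (- csin z).
Proof.
have h k : cderiv (fun w => cexp (k * w)) z (k * cexp (k * z)).
  have := @cderiv_affine R cexp k 0 z (cexp (k * z)).
  by rewrite addr0 => /(_ (cderiv_cexp _)); apply: cderiv_ext => w; rewrite addr0.
apply: cderiv_eq (cderivZ 2^-1 (cderivD (h 'i%C) (h (- 'i%C)))) _.
have i0 : 'i%C != 0 :> R[i] by rewrite -cabs_gt0 cabs_i.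
have i2 : 'i%C * 'i%C = -1 :> R[i] by rewrite -expr2 sqr_i.
have iV : 'i%C^-1 = - 'i%C :> R[i] by apply: (mulfI i0); rewrite divff// mulrN i2 opprK.
by rewrite /csin invfM iV; ring.
Qed.

Lemma cderiv_csin z : cderiv csin z (ccos z).
Proof.
have h k : cderiv (fun w => cexp (k * w)) z (k * cexp (k * z)).
  have := @cderiv_affine R cexp k 0 z (cexp (k * z)).
  by rewrite addr0 => /(_ (cderiv_cexp _)); apply: cderiv_ext => w; rewrite addr0.
apply: cderiv_eq (cderivZ (2 * 'i%C)^-1 (cderivB (h 'i%C) (h (- 'i%C)))) _.
have i0 : 'i%C != 0 :> R[i] by rewrite -cabs_gt0 cabs_i.
rewrite /ccos; field; exact: i0.
Qed.

Lemma ccos_real x : ccos x%:C = (cos x)%:C.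
Proof. by rewrite ccosE oppr0 expR0 subrr mul0r mulr0 (_ : (1 + 1) / 2 = 1 :> R) ?mulr1//; lra. Qed.

Lemma ccos_eq0 x y : ccos (x +i* y) = 0 -> y = 0 /\ cos x = 0.
Proof.
rewrite ccosE => -[/eqP]; rewrite mulf_eq0 => /orP[/eqP c0|]; last first.
  by rewrite gt_eqF// divr_gt0// addr_gt0// expR_gt0.
move=> /eqP; rewrite !mulf_eq0 invr_eq0 pnatr_eq0 orbF => /orP[/eqP s0|].
  have := cos2Dsin2 x; rewrite c0 s0 expr0n addr0 => /esym/eqP.
  by rewrite oner_eq0.
by rewrite subr_eq0 => /eqP /expR_inj h; split=> //; lra.
Qed.

Lemma cos_root_unique p x : cos p = 0 -> cos x = 0 -> `|x - p| < pi -> x = p.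
Proof.
move=> cp cx.
have : sin (x - p) = 0 by rewrite sinB cp cx mulr0 mul0r subrr.
case: (ltgtP x p) => // xp s0.
  rewrite ltr0_norm ?subr_lt0// => h.
  have h2 : 0 < - (x - p) < pi by rewrite h oppr_gt0 subr_lt0 xp.
  by have := sin_gt0_pi h2; rewrite sinN s0 oppr0 ltxx.
rewrite gtr0_norm ?subr_gt0// => h.
have h2 : 0 < x - p < pi by rewrite h subr_gt0 xp.
by have := sin_gt0_pi h2; rewrite s0 ltxx.
Qed.

(** Real and imaginary parts of [cos (x + i y)] have moduli [|cos x| cosh y] and [|sin x| sinh |y|].
    If [|cos x| >= 1/2], the first is at least [e^|y| / 4]. Otherwise [|sin x| >= 1/2] and
    [|y| >= 1], and [sinh |y| >= e^|y| / 4] gives the constant 8. The two alternatives serve the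
    vertical and the horizontal sides of the contour. *)
Lemma ccos_lower x y : cos x ^+ 2 = 2^-1 \/ 1 <= `|y| ->
  expR `|y| <= 8 * cabs (ccos (x +i* y)).
Proof.
set N := cabs _.
have hR : `|cos x| * `|(expR y + expR (- y)) / 2| <= N.
  by rewrite -normrM; have := Re_le_cabs (ccos (x +i* y)); rewrite {1}ccosE.
have hI : `|sin x| * `|(expR (- y) - expR y) / 2| <= N.
  by rewrite -normrM; have := Im_le_cabs (ccos (x +i* y)); rewrite {1}ccosE.
have e0 : 0 < expR y := expR_gt0 y. have e0' : 0 < expR (- y) := expR_gt0 (- y).
have E1 : `|(expR y + expR (- y)) / 2| = (expR `|y| + expR (- `|y|)) / 2.
  rewrite ger0_norm; last by rewrite divr_ge0// addr_ge0// ltW.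
  by case: (leP 0 y) => h; [rewrite ger0_norm|rewrite ltr0_norm// opprK addrC].
have E2 : `|(expR (- y) - expR y) / 2| = (expR `|y| - expR (- `|y|)) / 2.
  rewrite normrM (ger0_norm (_ : 0 <= 2^-1)) ?invr_ge0//; congr (_ / 2).
  case: (leP 0 y) => h; [rewrite (ger0_norm h) distrC|rewrite (ltr0_norm h) opprK].
    by rewrite ger0_norm// subr_ge0 ler_expR; lra.
  by rewrite ger0_norm// subr_ge0 ler_expR; lra.
rewrite {}E1 in hR; rewrite {}E2 in hI.
have k0 := expR_gt0 `|y|; have k0' := expR_gt0 (- `|y|).
have csE := cos2Dsin2 x.
have n1 : `|cos x| ^+ 2 = cos x ^+ 2 by rewrite real_normK// num_real.
have n2 : `|sin x| ^+ 2 = sin x ^+ 2 by rewrite real_normK// num_real.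
have big (u : R) : 0 <= u -> 4^-1 <= u ^+ 2 -> 2^-1 <= u.
  by move=> u0 hu; rewrite leNgt; apply/negP => h; nra.
have useC : 2^-1 <= `|cos x| -> expR `|y| <= 8 * N.
  move=> h; have : 2^-1 * ((expR `|y| + expR (- `|y|)) / 2) <=
     `|cos x| * ((expR `|y| + expR (- `|y|)) / 2) by rewrite ler_wpM2r//; lra.
  by move: hR; lra.
case=> [c2|y1]; first by apply/useC/big => //; rewrite n1 c2; lra.
case: (leP 2^-1 `|cos x|) => [//|hc].
have hs : 2^-1 <= `|sin x|.
  apply: big => //; rewrite n2; have : `|cos x| ^+ 2 <= 4^-1; last by rewrite n1; lra.
  have := normr_ge0 (cos x); nra.
have ey : 2 <= expR `|y| by rewrite (le_trans _ (expR_ge1Dx _))//; lra.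
have ey' : expR (- `|y|) <= 1 by rewrite expRN invf_le1//; lra.
have : 2^-1 * ((expR `|y| - expR (- `|y|)) / 2) <=
     `|sin x| * ((expR `|y| - expR (- `|y|)) / 2) by rewrite ler_wpM2r//; lra.
by move: hI; lra.
Qed.

End Cexp.

(** * Riesz' interpolation formula *)

(* Oddness of [G] makes the pole of [F] at 0 simple, and the residues at [s] and [- s] equal. *)
Section RieszOdd.
Context {R : realType} (T : R) (T0 : 0 < T) (C0 : R) (G : R[i] -> R[i]) (d : R[i]).
Hypotheses (hG : forall z, holo G z) (Godd : forall z, G (- z) = - G z)
  (dG : cderiv G 0 d)
  (bG : forall x y : R, cabs (G (x +i* y)) <= C0 * expR (T * `|y|)).
Implicit Types (x y s a b Y : R) (z : R[i]).

Let D z := ccos (T%:C * z).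

Let F z := G z / (z * z * D z).

Let res s : R[i] := G s%:C / (s ^+ 2 * (- T * sin (T * s)))%:C.

Let TC x y : T%:C * (x +i* y) = (T * x) +i* (T * y).
Proof. by apply/eqP; rewrite eq_complex/=; apply/andP; split; apply/eqP; ring. Qed.

Let derD z : cderiv D z (- T%:C * csin (T%:C * z)).
Proof.
have := @cderiv_affine R (@ccos R) T%:C 0 z _ (cderiv_ccos _).
rewrite mulrN -mulNr addr0 => h; apply: cderiv_ext h => w.
by rewrite addr0.
Qed.

Let D_neq0 x y : y != 0 \/ cos (T * x) != 0 -> D (x +i* y) != 0.
Proof.
move=> h; apply/eqP; rewrite /D TC => /ccos_eq0[/eqP].
rewrite mulf_eq0 (gt_eqF T0)/= => y0 c0.
by case: h => /negP; apply; rewrite ?y0 ?c0.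
Qed.

Let holoF z : z != 0 -> D z != 0 -> holo F z.
Proof.
move=> z0 Dz; have [g hg] := hG z; eexists; apply: cderivM; first exact: hg.
apply: cderivV; first by apply: mulf_neq0 => //; exact: mulf_neq0.
by apply: cderivM; [apply: cderivM; exact: cderiv_id|exact: derD].
Qed.

Let neq0c x y : x != 0 \/ y != 0 -> x +i* y != 0.
Proof. by move=> h; apply/eqP => -[x0 y0]; case: h; rewrite ?x0 ?y0 eqxx. Qed.

(** Here the derivative enters the formula: [G 0 = 0], so [z * F z] is the difference quotient of
    [G] at 0 divided by [D z], and [D 0 = 1]. *)
Let pole0 : pole F 0 d.
Proof.
have D0 : D 0 = 1 by rewrite /D mulr0 -(rmorph0 (real_complex R)) ccos_real cos0.
have G0 : G 0 = 0.
  have := Godd 0; rewrite oppr0 => /eqP; rewrite -addr_eq0 -mulr2n mulrn_eq0/=.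
  by move/eqP.
have : climit (fun w => (G w - G 0) / (w - 0) * (D w)^-1) 0 (d * 1^-1).
  apply: climitM; first exact: climit_slope.
  apply: climitV; first exact: oner_neq0.
  by rewrite -D0; apply: climit_holo; eexists; exact: derD.
rewrite invr1 mulr1; apply: climit_ext => w w0.
rewrite G0 !subr0 /F; move: (D w) (G w) => u v; rewrite !invfM.
by move: (u^-1) => u'; field.
Qed.

Let pole_cos s : s != 0 -> cos (T * s) = 0 -> pole F (s +i* 0) (res s).
Proof.
move=> s0 cs; have Ds : D (s +i* 0) = 0 by rewrite /D TC mulr0 ccos_real cs.
have sz : s +i* 0 != 0 :> R[i] by apply: neq0c; left.
have sins : sin (T * s) != 0.
  apply/eqP => ss; have := cos2Dsin2 (T * s); rewrite cs ss expr0n addr0.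
  by move/esym/eqP; rewrite oner_eq0.
have dD : cderiv D (s +i* 0) (- T * sin (T * s))%:C.
  apply: cderiv_eq (derD _) _.
  by rewrite TC mulr0 csinE rmorphM rmorphN.
have : climit (fun w => G w * (w * w)^-1 * ((D w - D (s +i* 0)) / (w - (s +i* 0)))^-1) (s +i* 0)
   (G (s +i* 0) * ((s +i* 0) * (s +i* 0))^-1 * ((- T * sin (T * s))%:C)^-1).
  apply: climitM; first apply: climitM.
  - exact: climit_holo.
  - apply: climitV; first exact: mulf_neq0.
    by apply: climitM; apply: climit_holo; eexists; exact: cderiv_id.
  - apply: climitV; last exact: climit_slope.
    by rewrite (inj_eq (@complexI R)) mulf_neq0// oppr_eq0 gt_eqF.
have -> : G (s +i* 0) * ((s +i* 0) * (s +i* 0))^-1 * ((- T * sin (T * s))%:C)^-1 = res s.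
  rewrite /res -mulrA -invfM; congr (_ / _).
  by rewrite -[s +i* 0]/(s%:C) -!rmorphM expr2.
apply: climit_ext => w wz.
have wz' : w - (s +i* 0) != 0 by rewrite subr_eq0.
rewrite Ds subr0 /F; move: (D w) (G w) => u v; rewrite !invfM invrK.
by ring.
Qed.

(** All zeros of [cos (T z)] are real, and distinct ones are at least [pi / T] apart, so [s] is the
    only singularity of [F] in the column. *)
Let residue_column s a b Y : cos (T * s) = 0 -> a < s -> s < b -> 0 < Y ->
  (forall x, a <= x <= b -> x != 0 /\ `|x - s| < pi / T) ->
  rint F a b (- Y) Y = 2 * pi%:C * 'i%C * res s.
Proof.
move=> cs as_ sb Y0 hx.
have s0 : s != 0 by have [] := hx s; rewrite ?(ltW as_) ?(ltW sb).
apply: residue (pole_cos s0 cs) => //; first by rewrite oppr_lt0.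
move=> x y xab yY xys; have [x0 xs] := hx x xab.
apply: holoF; first by apply: neq0c; left.
apply: D_neq0; have [y0|] := eqVneq y 0; last by left.
right; apply/eqP => cx; move/eqP: xys; apply; congr (_ +i* _); last by [].
apply: (mulfI (lt0r_neq0 T0)); apply: cos_root_unique => //.
by rewrite -mulrBr normrM gtr0_norm// mulrC -ltr_pdivlMr.
Qed.

(* [cos (T a_k)^2 = 1/2], so [|cos (T z)|] is bounded below by a multiple of
   [e^(T |y|)] on the vertical line through [a_k]; between [a_k] and [a_(k+1)] the
   only zero of [cos (T z)] is [node k]. *)
Let a_ (k : nat) : R := pi / (4 * T) + k%:R * (pi / T).

Definition node (k : nat) : R := pi / (2 * T) + k%:R * (pi / T).

Let a_gt0 k : 0 < a_ k.
Proof.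
have pT : 0 < pi / T by rewrite divr_gt0// pi_gt0.
by rewrite ltr_pwDl// ?divr_gt0 ?pi_gt0 ?mulr_gt0// mulr_ge0// ltW.
Qed.

Let Ta k : T * a_ k = pi / 4 + k%:R * pi.
Proof. rewrite /a_; field; exact: lt0r_neq0. Qed.

Let cos_a k : cos (T * a_ k) ^+ 2 = 2^-1.
Proof.
rewrite Ta; elim: k => [|k]; last first.
  have -> : pi / 4 + k.+1%:R * pi = pi / 4 + k%:R * pi + pi :> R by ring.
  by rewrite cosDpi sqrrN.
rewrite mul0r addr0.
have : cos (pi / 4 *+ 2) = 0 :> R.
  by rewrite (_ : pi / 4 *+ 2 = pi / 2) ?cos_pihalf// mulr2n; lra.
rewrite cos_mulr2n => /eqP; rewrite subr_eq0 mulr2n => /eqP; lra.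
Qed.

Lemma cos_node k : cos (T * node k) = 0.
Proof.
have -> : T * node k = pi / 2 + k%:R * pi by rewrite /node; field; exact: lt0r_neq0.
elim: k => [|k]; first by rewrite mul0r addr0 cos_pihalf.
have -> : pi / 2 + k.+1%:R * pi = pi / 2 + k%:R * pi + pi :> R by ring.
by rewrite cosDpi => ->; rewrite oppr0.
Qed.

Let node_a k : a_ k < node k /\ node k < a_ k.+1.
Proof.
have pT : 0 < pi / T by rewrite divr_gt0// pi_gt0.
rewrite /a_ /node !invfM -[k.+1%:R]natr1; split.
  have : 4^-1 * (pi / T) < 2^-1 * (pi / T) by rewrite ltr_pM2r//; lra.
  lra.
have : 2^-1 * (pi / T) < 4^-1 * (pi / T) + pi / T by lra.
lra.
Qed.

Let node_dist k x : a_ k <= x <= a_ k.+1 -> `|x - node k| < pi / T.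
Proof.
have pT : 0 < pi / T by rewrite divr_gt0// pi_gt0.
by rewrite /a_ /node !invfM -[k.+1%:R]natr1 ltr_norml; lra.
Qed.

Let cos_a_neq0 k : cos (T * a_ k) != 0.
Proof. by rewrite -sqrf_eq0 cos_a invr_eq0 pnatr_eq0. Qed.

Let cos_Na_neq0 k : cos (T * (- a_ k)) != 0.
Proof. by rewrite mulrN cosN. Qed.

Let resN s : res (- s) = res s.
Proof.
rewrite /res rmorphN Godd sqrrN (mulrN T) sinN (mulrN (- T)) (mulrN (s ^+ 2)).
by rewrite rmorphN /= invrN mulrNN.
Qed.

Let a_mono k : a_ k <= a_ k.+1.
Proof. by have [h1 h2] := node_a k; exact: ltW (lt_trans h1 h2). Qed.

Let a_le k : a_ 0%N <= a_ k.
Proof. by elim: k => // k /le_trans; apply. Qed.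

Let sum_right n Y : 0 < Y ->
  rint F (a_ 0) (a_ n) (- Y) Y = 2 * pi%:C * 'i%C * \sum_(k < n) res (node k).
Proof.
move=> Y0; elim: n => [|n IH].
  (* With no column the rectangle degenerates to the segment on [x = a_ 0], which avoids all
     poles. *)
  rewrite big_ord0 mulr0; apply: goursat => //; first lra.
  move=> x y hx hy; have -> : x = a_ 0 by move: hx; lra.
  by apply: holoF; [apply: neq0c; left; exact: lt0r_neq0|apply: D_neq0; right].
rewrite big_ord_recr/= mulrDr -IH -(@residue_column _ (a_ n) (a_ n.+1) Y)//; last 4 first.
- exact: cos_node.
- by have [] := node_a n.
- by have [] := node_a n.
- move=> x hx; split; last exact: node_dist.
  by rewrite gt_eqF//; have := a_gt0 n; move: hx; lra.
apply: rint_splitx => //; first lra.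
move=> x y hx hy hxy; apply: holoF.
  by apply: neq0c; left; rewrite gt_eqF//; have := a_gt0 0; move: hx; lra.
apply: D_neq0.
by case/or4P: hxy => [/eqP->|/eqP->|/eqP->|/orP[]/eqP->]; [right..|left|left] => //;
  rewrite ?oppr_eq0 gt_eqF.
Qed.

Let sum_left n Y : 0 < Y ->
  rint F (- a_ n) (- a_ 0) (- Y) Y = 2 * pi%:C * 'i%C * \sum_(k < n) res (node k).
Proof.
move=> Y0; elim: n => [|n IH].
  rewrite big_ord0 mulr0; apply: goursat => //; first lra.
  move=> x y hx hy; have -> : x = - a_ 0 by move: hx; lra.
  apply: holoF; last by apply: D_neq0; right.
  by apply: neq0c; left; rewrite oppr_eq0; exact: lt0r_neq0.
rewrite big_ord_recr/= mulrDr -IH -(resN (node n)).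
rewrite -(@residue_column _ (- a_ n.+1) (- a_ n) Y)//; last 4 first.
- by rewrite mulrN cosN cos_node.
- by rewrite ltrN2; have [] := node_a n.
- by rewrite ltrN2; have [] := node_a n.
- move=> x hx; split.
    by rewrite lt_eqF//; have := a_gt0 n; move: hx; lra.
  have -> : x - - node n = - (- x - node n) by ring.
  by rewrite normrN; apply: node_dist; move: hx; lra.
rewrite [RHS]addrC; have := a_mono n; have := a_le n => an0 ann.
apply: rint_splitx; [lra|lra|lra|].
move=> x y hx hy hxy; apply: holoF.
  by apply: neq0c; left; rewrite lt_eqF//; have := a_gt0 0; move: hx; lra.
apply: D_neq0.
by case/or4P: hxy => [/eqP->|/eqP->|/eqP->|/orP[]/eqP->]; [right..|left|left] => //;
  rewrite ?oppr_eq0 gt_eqF.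
Qed.

(** For [|x| <= a_ 0] one has [|T x| <= pi / 4], so the cosine has no zero and 0 is the only
    singularity. *)
Let sum_center Y : 0 < Y ->
  rint F (- a_ 0) (a_ 0) (- Y) Y = 2 * pi%:C * 'i%C * d.
Proof.
move=> Y0; have h0 := a_gt0 0.
apply: (@residue _ F 0 0) pole0; rewrite ?oppr_lt0//.
move=> x y hx hy xy0; apply: holoF => //; apply: D_neq0.
right; rewrite gt_eqF//; apply: cos_gt0_pihalf.
have := pi_gt0 R => p0; have := Ta 0; rewrite mul0r addr0 => Ta0.
have h1 : T * x <= T * a_ 0 by rewrite ler_pM2l//; move: hx; lra.
have h2 : T * (- a_ 0) <= T * x by rewrite ler_pM2l//; move: hx; lra.
by rewrite mulrN in h2; move: h1 h2; rewrite Ta0; lra.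
Qed.

Let rint_square n Y : 0 < Y ->
  rint F (- a_ n) (a_ n) (- Y) Y = 2 * pi%:C * 'i%C * (d + 2 * \sum_(k < n) res (node k)).
Proof.
move=> Y0; have h0 := a_gt0 0; have hn := a_gt0 n; have h0n := a_le n.
have H x y : [|| x == - a_ n, x == - a_ 0, x == a_ 0, x == a_ n, y == - Y | y == Y] ->
    holo F (x +i* y).
  move=> hxy; apply: holoF.
    apply: neq0c; move: hxy; do 4?case/predU1P => [->|]; [left..|].
    - by rewrite oppr_eq0 gt_eqF.
    - by rewrite oppr_eq0 gt_eqF.
    - by rewrite gt_eqF.
    - by rewrite gt_eqF.
    by case/orP => /eqP ->; right; rewrite ?oppr_eq0 gt_eqF.
  apply: D_neq0; move: hxy; do 4?case/predU1P => [->|]; [right..|] => //.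
  by case/orP => /eqP ->; left; rewrite ?oppr_eq0 gt_eqF.
rewrite (@rint_splitx _ F (- a_ n) (- a_ 0)); [|lra|lra|lra|]; last first.
  by move=> x y _ _ hxy; apply: H; move: hxy; do 4?case/predU1P => [->|]; last move/eqP => ->;
    rewrite eqxx ?orbT.
rewrite (@rint_splitx _ F (- a_ 0) (a_ 0)); [|lra|lra|lra|]; last first.
  by move=> x y _ _ hxy; apply: H; move: hxy; do 4?case/predU1P => [->|]; last move/eqP => ->;
    rewrite eqxx ?orbT.
rewrite sum_left// sum_right// sum_center//; ring.
Qed.

Let C0_ge0 : 0 <= C0.
Proof.
by have := bG 0 0; rewrite normr0 mulr0 expR0 mulr1; apply: le_trans; exact: cabs_ge0.
Qed.

(** The growth of [G] and of [cos (T z)] cancel, and only the factor [1 / |z|^2] remains. *)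
Let F_bound x y a : 0 < a -> a <= cabs (x +i* y) ->
  cos (T * x) ^+ 2 = 2^-1 \/ 1 <= `|T * y| -> cabs (F (x +i* y)) <= 8 * C0 / a ^+ 2.
Proof.
move=> a0 az hxy.
have zn : 0 < cabs (x +i* y) by exact: lt_le_trans az.
have E0 : 0 < expR (T * `|y|) := expR_gt0 _.
have Dn : expR (T * `|y|) <= 8 * cabs (D (x +i* y)).
  by rewrite /D TC; have := ccos_lower hxy; rewrite normrM (gtr0_norm T0).
have D0 : 0 < cabs (D (x +i* y)) by move: Dn; lra.
rewrite /F cabsM cabsV (cabsM (_ * _) (D _)) (cabsM (x +i* y)) ler_pdivrMr ?mulr_gt0//.
apply: (le_trans (bG x y)).
have a2 : 0 < a ^+ 2 by rewrite exprn_gt0.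
have za : a ^+ 2 <= cabs (x +i* y) * cabs (x +i* y).
  by rewrite expr2; apply: ler_pM => //; exact: ltW.
apply: (@le_trans _ _ (C0 * (8 * cabs (D (x +i* y))))); first by rewrite ler_wpM2l.
have -> : 8 * C0 / a ^+ 2 * (cabs (x +i* y) * cabs (x +i* y) * cabs (D (x +i* y))) =
  C0 * (8 * cabs (D (x +i* y))) * ((cabs (x +i* y) * cabs (x +i* y)) / a ^+ 2).
  by field; exact: lt0r_neq0.
rewrite ler_peMr//; first by rewrite !mulr_ge0// ltW.
by rewrite ler_pdivlMr// mul1r.
Qed.

(** On the square of half-side [a_ n] the bound [8 C0 / a_n^2] gives a contour integral of modulus
    at most [128 C0 / a_n]. Dividing by [2 pi >= 1] and using [T a_n >= n] yields the stated
    error. *)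
Lemma riesz_odd (n : nat) : (0 < n)%N ->
  cabs (d + 2 * \sum_(k < n) (G (node k)%:C / (node k ^+ 2 * (- T * sin (T * node k)))%:C))
  <= 128 * C0 * T / n%:R.
Proof.
move=> n0; have an := a_gt0 n.
(* Needed for [ccos_lower] on the horizontal sides; it fails for [n = 0], where
   [T * a_ 0 = pi / 4]. *)
have Tan : 1 <= T * a_ n.
  rewrite Ta; have := pi_ge2 R; have := pi_gt0 R.
  have : (1 : R) <= n%:R by rewrite ler1n.
  by nra.
have B : cabs (rint F (- a_ n) (a_ n) (- a_ n) (a_ n)) <=
    4 * (8 * C0 / a_ n ^+ 2) * (a_ n - - a_ n + (a_ n - - a_ n)).
  apply: rint_bound; [lra|lra|].
  move=> x y hx hy hxy.
  have naE : `|- a_ n| = a_ n by rewrite normrN gtr0_norm.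
  have aE : `|a_ n| = a_ n by rewrite gtr0_norm.
  have hz : a_ n <= cabs (x +i* y).
    case/or4P: hxy => /eqP E.
    - by rewrite (le_trans _ (Re_le_cabs _))//= E naE.
    - by rewrite (le_trans _ (Re_le_cabs _))//= E aE.
    - by rewrite (le_trans _ (Im_le_cabs _))//= E naE.
    - by rewrite (le_trans _ (Im_le_cabs _))//= E aE.
  have hc : cos (T * x) ^+ 2 = 2^-1 \/ 1 <= `|T * y|.
    case/or4P: hxy => /eqP ->.
    - by left; rewrite mulrN cosN cos_a.
    - by left; rewrite cos_a.
    - by right; rewrite normrM (gtr0_norm T0) naE.
    - by right; rewrite normrM (gtr0_norm T0) aE.
  split; last exact: F_bound.
  apply: holoF; first by rewrite -cabs_gt0 (lt_le_trans an).
  rewrite -cabs_gt0 /D TC; have := ccos_lower hc; have := expR_gt0 `|T * y|; lra.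
move: B; rewrite rint_square// cabsM.
set X := cabs (d + _).
have -> : cabs (2 * pi%:C * 'i%C : R[i]) = 2 * pi.
  rewrite !cabsM cabs_i mulr1 cabsR (gtr0_norm (pi_gt0 R)).
  by rewrite -(rmorph_nat (real_complex R)) cabsR ger0_norm.
have -> : 4 * (8 * C0 / a_ n ^+ 2) * (a_ n - - a_ n + (a_ n - - a_ n)) = 128 * C0 * (a_ n)^-1.
  by field; exact: lt0r_neq0.
have X0 : 0 <= X := cabs_ge0 _.
have p1 := pi_ge2 R => B.
have XB : X <= 128 * C0 * (a_ n)^-1.
  apply: le_trans B; rewrite ler_peMl//; lra.
apply: (le_trans XB); rewrite -[leRHS]mulrA ler_wpM2l ?mulr_ge0//.
rewrite -[leRHS]invrK lef_pV2 ?posrE ?invr_gt0 ?divr_gt0 ?ltr0n// invf_div.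
rewrite ler_pdivrMr// mulrC Ta.
have : n%:R <= n%:R * pi :> R by rewrite ler_peMr//; lra.
by have := pi_gt0 R; lra.
Qed.

End RieszOdd.

(** * The pointwise inequality with finitely many nodes *)

Section BernsteinPoint.
Context {R : realType} (T : R) (T0 : 0 < T).
Implicit Types (G : R[i] -> R[i]) (C q : R).

(** Equal to [8 / ((2 k + 1)^2 pi^2)], hence independent of [T]. It is the coefficient
    [2 / (T p_k^2)] of the paired residues with a factor [T] taken out. *)
Definition weight (k : nat) : R := 2 / (T ^+ 2 * node T k ^+ 2).

Lemma node_gt0 k : 0 < node T k.
Proof.
have pT : 0 < pi / T by rewrite divr_gt0// pi_gt0.
by rewrite ltr_pwDl// ?divr_gt0 ?pi_gt0 ?mulr_gt0// mulr_ge0// ltW.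
Qed.

Lemma weight_ge0 k : 0 <= weight k.
Proof. by rewrite divr_ge0// mulr_ge0// sqr_ge0. Qed.

Lemma sin_node k : `|sin (T * node T k)| = 1.
Proof.
have := cos2Dsin2 (T * node T k); rewrite cos_node// expr0n add0r => /eqP.
by rewrite sqrf_eq1 => /orP[]/eqP->; rewrite ?normrN normr1.
Qed.

Lemma le_of_le_invn (a b c : R) : (forall n, (0 < n)%N -> a <= b + c / n%:R) -> a <= b.
Proof.
move=> h; rewrite leNgt; apply/negP => ab.
have ba : 0 < a - b by lra.
pose n := (Num.truncn (`|c| / (a - b))).+1.
have hn : `|c| / (a - b) < n%:R by exact: truncnS_gt.
have n0 : 0 < n%:R :> R by rewrite ltr0n.
have := h n isT; rewrite -lerBlDl ler_pdivlMr//.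
move: hn; rewrite ltr_pdivrMr//; have := ler_norm c; lra.
Qed.

(* Riesz' formula for [sin (T z)], all of whose terms have the same sign. *)
Lemma sum_weight_le1 n : \sum_(k < n) weight k <= 1.
Proof.
pose G z := csin (T%:C * z).
have TC x y : T%:C * (x +i* y) = (T * x) +i* (T * y).
  by apply/eqP; rewrite eq_complex/=; apply/andP; split; apply/eqP; ring.
have dG z : cderiv G z (T%:C * ccos (T%:C * z)).
  have := @cderiv_affine R (@csin R) T%:C 0 z _ (cderiv_csin _).
  by rewrite addr0 => h; apply: cderiv_ext h => w; rewrite addr0.
have Godd z : G (- z) = - G z.
  have E1 : 'i%C * (T%:C * - z) = - 'i%C * (T%:C * z) by ring.
  have E2 : - 'i%C * (T%:C * - z) = 'i%C * (T%:C * z) by ring.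
  by rewrite /G /csin E1 E2; ring.
have dG0 : cderiv G 0 T%:C.
  apply: cderiv_eq (dG 0) _.
  by rewrite mulr0 -(rmorph0 (real_complex R)) ccos_real cos0 mulr1.
have bG (x y : R) : cabs (G (x +i* y)) <= 1 * expR (T * `|y|).
  by rewrite /G TC mul1r (le_trans (cabs_csin_le _ _))// normrM (gtr0_norm T0).
have hG z : holo G z by eexists; exact: dG.
have key m : (0 < m)%N -> \sum_(k < m) weight k <= 1 + 128 / m%:R.
  move=> m0; have := riesz_odd T0 hG Godd dG0 bG m0.
  have -> : T%:C + 2 * (\sum_(k < m) G (node T k)%:C /
      (node T k ^+ 2 * (- T * sin (T * node T k)))%:C) = (T * (1 - \sum_(k < m) weight k))%:C.
    rewrite mulrBr mulr1 rmorphB /=; congr (_ + _).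
    rewrite mulr_sumr mulr_sumr -(rmorphN (real_complex R)) -sumrN rmorph_sum /=.
    apply: eq_bigr => k _; rewrite /G -rmorphM csinE -fmorphV -rmorphM.
    rewrite -(rmorph_nat (real_complex R)) -rmorphM; congr (_%:C).
    have s1 := sin_node k; rewrite /weight; field.
    rewrite (gt_eqF T0) (gt_eqF (node_gt0 k)) /= -normr_eq0 s1 oner_eq0//.
  rewrite cabsR normrM (gtr0_norm T0) mulr1 -mulrA [leRHS]mulrCA ler_pM2l//.
  have := ler_norm (- (1 - \sum_(k < m) weight k)); rewrite normrN; lra.
(* [n] stays fixed while [m] grows. For [n <= m] the partial sums increase; for [m < n] the error in
   [key n] is already smaller than [128 / m]. *)
apply: (@le_of_le_invn _ _ 128) => m m0.
have [nm|/ltnW mn] := leqP n m.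
  apply: le_trans (key m m0).
  rewrite -!(big_mkord xpredT) (big_cat_nat (leq0n n) nm)//= lerDl sumr_ge0// => k _; exact: weight_ge0.
have n0 := leq_trans m0 mn.
apply: (le_trans (key n n0)); rewrite lerD2l ler_wpM2l// lef_pV2 ?posrE ?ltr0n//.
by rewrite ler_nat.
Qed.

(** The odd part [Go] has the same derivative at 0 and obeys the same growth bound. As
    [|sin (T p_k)| = 1], the term of index [k] is at most [T * weight k] times the mean of [|G|] at
    the two nodes. *)
Lemma bernstein_point G d C : (forall z, holo G z) -> cderiv G 0 d ->
  (forall x y : R, cabs (G (x +i* y)) <= C * expR (T * `|y|)) ->
  forall n, (0 < n)%N ->
  cabs d <= T * \sum_(k < n) weight k *
      ((cabs (G (node T k)%:C) + cabs (G (- node T k)%:C)) / 2) + 128 * C * T / n%:R.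
Proof.
move=> hG dG bG n n0.
pose Go z := 2^-1 * (G z - G (- z)).
have dN z e : cderiv G (- z) e -> cderiv (fun w => G (- w)) z (- e).
  move=> h; have := @cderiv_affine R G (-1) 0 z e.
  rewrite mulN1r addr0 mulN1r => /(_ h); apply: cderiv_ext => w.
  by rewrite mulN1r addr0.
have hGo z : holo Go z.
  have [e1 h1] := hG z; have [e2 h2] := hG (- z).
  by eexists; apply: cderivZ; apply: cderivB; [exact: h1|apply: dN; exact: h2].
have Godd z : Go (- z) = - Go z by rewrite /Go opprK; ring.
have dGo : cderiv Go 0 d.
  apply: cderiv_eq (cderivZ _ (cderivB dG (dN 0 d _))) _; first by rewrite oppr0.
  by field.
have c2 : cabs (2^-1 : R[i]) = 2^-1.
  by rewrite cabsV -(rmorph_nat (real_complex R)) cabsR ger0_norm.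
have Go_le z : cabs (Go z) <= (cabs (G z) + cabs (G (- z))) / 2.
  by rewrite /Go cabsM c2 mulrC ler_wpM2r// cabsB.
have bGo (x y : R) : cabs (Go (x +i* y)) <= C * expR (T * `|y|).
  apply: (le_trans (Go_le _)).
  have h1 := bG x y; have := bG (- x) (- y); rewrite normrN => h2.
  rewrite (_ : - (x +i* y) = (- x) +i* (- y)); last by [].
  by move: h1 h2; lra.
have := riesz_odd T0 hGo Godd dGo bGo n0.
set S := 2 * _ => hS.
have S_le : cabs S <= T * \sum_(k < n) weight k *
      ((cabs (G (node T k)%:C) + cabs (G (- node T k)%:C)) / 2).
  rewrite /S 2!mulr_sumr (le_trans (cabs_sum _ _ _))//; apply: ler_sum => k _.
  rewrite cabsM cabsM cabsV -(rmorph_nat (real_complex R)) !cabsR (ger0_norm (ler0n R 2)).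
  rewrite (normrM (_ ^+ 2)) normrX (gtr0_norm (node_gt0 k)) (normrM (- T)) normrN.
  rewrite (gtr0_norm T0) sin_node mulr1.
  have n1 := gt_eqF (node_gt0 k); have t1 := gt_eqF T0.
  have -> : 2 * (cabs (Go (node T k)%:C) / (node T k ^+ 2 * T)) =
     T * weight k * cabs (Go (node T k)%:C).
    by rewrite /weight; field; rewrite n1 t1.
  rewrite -mulrA ler_pM2l// ler_wpM2l ?weight_ge0// (le_trans (Go_le _))//.
  by rewrite rmorphN.
have := cabsB (d + S) S; rewrite addrK; move: hS S_le.
by lra.
Qed.

(** Translation by [x + i t] costs a factor [e^(T |t|)] in the growth constant, because
    [|y + t| <= |y| + |t|]. That constant occurs only in the error, so the main sum keeps the factor
    [T]. *)
Lemma bernstein_shift G d C x t : (forall z, holo G z) -> cderiv G (x +i* t) d ->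
  (forall x y : R, cabs (G (x +i* y)) <= C * expR (T * `|y|)) ->
  forall n, (0 < n)%N ->
  cabs d <= T * \sum_(k < n) weight k *
      ((cabs (G ((x + node T k) +i* t)) + cabs (G ((x - node T k) +i* t))) / 2)
    + 128 * (C * expR (T * `|t|)) * T / n%:R.
Proof.
move=> hG dG bG n n0.
pose H z := G (1 * z + (x +i* t)).
have dH z e : cderiv G (z + (x +i* t)) e -> cderiv H z e.
  move=> h; have := @cderiv_affine R G 1 (x +i* t) z e; rewrite !mul1r => /(_ h).
  by apply: cderiv_ext.
have HE (u : R) : H u%:C = G ((x + u) +i* t).
  rewrite /H mul1r; congr G; apply/eqP; rewrite eq_complex/= add0r.
  by apply/andP; split; apply/eqP; ring.
under eq_bigr do rewrite -!HE.
apply: (@bernstein_point H d (C * expR (T * `|t|)) _ _ _ n n0).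
- by move=> z; have [e he] := hG (z + (x +i* t)); exists e; exact: dH.
- by apply: dH; rewrite add0r.
- move=> u v; rewrite /H mul1r (le_trans (bG _ _))//.
  rewrite -mulrA -expRD ler_wpM2l//.
    have := bG 0 0; rewrite normr0 mulr0 expR0 mulr1; apply: le_trans; exact: cabs_ge0.
  by rewrite ler_expR -mulrDr ler_pM2l// addrC ler_normD.
Qed.

End BernsteinPoint.

(** * Convexity *)

Section Jensen.
Context {R : realType}.

(* With [m] the sum on the left, sum Young's inequality
   [a m^(q-1) <= a^q / q + m^q (q-1) / q] against the weights. *)
Lemma powR_sum_le (n : nat) (w a : nat -> R) (q : R) : 1 <= q ->
  (forall k, 0 <= w k) -> (forall k, 0 <= a k) -> \sum_(k < n) w k <= 1 ->
  (\sum_(k < n) w k * a k) `^ q <= \sum_(k < n) w k * a k `^ q.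
Proof.
move=> q1 w0 a0 w1; set m := \sum_(k < n) w k * a k.
have m0 : 0 <= m by apply: sumr_ge0 => k _; rewrite mulr_ge0.
have [->|qn1] := eqVneq q 1.
  by rewrite powRr1//; apply: ler_sum => k _; rewrite powRr1.
have q1' : 1 < q by rewrite lt_neqAle eq_sym qn1.
have q0 : 0 < q by lra.
pose p := q / (q - 1).
have p0 : 0 < p by rewrite divr_gt0// subr_gt0.
have pq : q^-1 + p^-1 = 1 by rewrite /p invf_div; field; exact: lt0r_neq0.
have mq : (m `^ (q - 1)) `^ p = m `^ q.
  by rewrite -powRrM /p mulrCA divff ?mulr1// subr_eq0.
have mm : m `^ q = \sum_(k < n) w k * (a k * m `^ (q - 1)).
  transitivity (m * m `^ (q - 1)); last first.
    by rewrite {1}/m mulr_suml; apply: eq_bigr => k _; rewrite mulrA.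
  rewrite -{2}(powRr1 m0) -powRD; last by rewrite addrC subrK (gt_eqF q0).
  by rewrite addrC subrK.
have W0 : 0 <= m `^ q := powR_ge0 _ _.
have step : m `^ q <= q^-1 * (\sum_(k < n) w k * a k `^ q) + m `^ q / p.
  rewrite {1}mm; apply: (@le_trans _ _ (\sum_(k < n) w k * (a k `^ q / q + m `^ q / p))).
    apply: ler_sum => k _; rewrite ler_wpM2l// -mq.
    by rewrite (@conjugate_powR _ _ _ q p)// powR_ge0.
  under eq_bigr do rewrite mulrDr.
  rewrite big_split/= lerD//.
    by rewrite mulr_sumr ler_sum// => k _; rewrite mulrA mulrC.
  by rewrite -mulr_suml ler_piMl// divr_ge0// ltW.
have pE : p^-1 = 1 - q^-1 by lra.
rewrite pE mulrBr mulr1 in step.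
have : m `^ q / q <= q^-1 * (\sum_(k < n) w k * a k `^ q) by lra.
by rewrite mulrC ler_pM2l ?invr_gt0.
Qed.

Lemma powR_half_le (u v q : R) : 1 <= q -> 0 <= u -> 0 <= v ->
  ((u + v) / 2) `^ q <= (u `^ q + v `^ q) / 2.
Proof.
move=> q1 u0 v0.
have := @powR_sum_le 2 (fun=> 2^-1) (fun k => if k is 0%N then u else v) q q1.
rewrite !big_ord_recl !big_ord0 /= !addr0 -!mulrDr !(mulrC 2^-1); apply.
- by [].
- by case.
- by lra.
Qed.

End Jensen.

Lemma climit_near_ext (R : realType) (F G : R[i] -> R[i]) z l (r : R) : 0 < r ->
  (forall w, w != z -> cabs (w - z) < r -> F w = G w) -> climit F z l -> climit G z l.
Proof.
move=> r0 FG h e /h[del d0 hd]; exists (Num.min del r); first by rewrite lt_min d0.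
by move=> w wz; rewrite lt_min => /andP[h1 h2]; rewrite -FG//; exact: hd.
Qed.

(** * Logarithmic coordinates *)

Section LogCoordinates.
Context {R : realType} (c T : R) (f : R * R -> R[i]).
Hypothesis hf : polar_analytic f.

Definition logf (z : R[i]) : R[i] :=
  cexp (c%:C * z) * f (expR (complex.Re z), complex.Im z).

Let E (z : R[i]) : R * R := (expR (complex.Re z), complex.Im z).

(** The map [E] is continuous and injective, so it sends punctured neighbourhoods of [z] into
    punctured neighbourhoods of [E z], where polar analyticity applies. *)
Lemma climit_polar_quotient z :
  climit (fun w => polar_quotient f (E z) (E w)) z (Dpol f (E z)).
Proof.
move=> e e0.
have hP : halfplane (E z) by rewrite /halfplane /=; exact: expR_gt0.
have : polar_quotient f (E z) y @[y --> (E z)^'] --> (Dpol f (E z) : R[i]^o).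
  exact: hf hP.
have e0' : (0 : R[i]^o) < e%:C by rewrite ltcR.
move=> /cvgrPdist_le/(_ _ e0').
rewrite /prop_near1 /nbhs /= /dnbhs /within /= => /nbhs_ballP[r /= r0 hr].
have [d1 d10 h1] : exists2 d1 : R, 0 < d1 & forall x, `|x - complex.Re z| < d1 ->
    `|expR (complex.Re z) - expR x| < r.
  have := @continuous_expR R (complex.Re z).
  move=> /cvgrPdist_lt/(_ r r0) /nbhs_ballP[d1 /= d10 h1].
  by exists d1 => // x hx; apply: h1; rewrite /ball /= distrC.
exists (Num.min d1 r); first by rewrite lt_min d10.
move=> w wz; rewrite lt_min => /andP[w1 w2].
have := hr (E w); rewrite normcabs lecR cabsC; apply.
  split => /=.
    by apply: h1; rewrite -ReB (le_lt_trans (Re_le_cabs _)).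
  by rewrite /ball /= distrC -ImB (le_lt_trans (Im_le_cabs _)).
apply/eqP => -[/expR_inj h2 h3]; move/eqP: wz; apply.
by move: h2 h3; case: w {w1 w2} => ? ?; case: z {hP hr h1} => ? ? /= -> ->.
Qed.

(** The difference quotient of [f] composed with [E] is the polar quotient times the difference
    quotient of the exponential; the product rule with [e^(c z)] then adds the term [c f]. *)
Lemma cderiv_logf z : cderiv logf z (cexp (c%:C * z) * polar_mellin c f (E z)).
Proof.
have d1 : cderiv (fun w => f (E w)) z (polar (E z) * Dpol f (E z)).
  apply: slope_cderiv.
  have hs := climit_slope (cderiv_cexp z).
  (* Within this tolerance the slope of the exponential cannot vanish, so [e^w] differs from [e^z]
     near [z] and may be cancelled. *)
  have n0 : 0 < cabs (cexp z) / 2 by rewrite divr_gt0// cabs_gt0 cexp_neq0.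
  have [r r0 hr] := hs _ n0.
  rewrite mulrC; apply: climit_near_ext r0 _ (climitM (@climit_polar_quotient z) hs).
  move=> w wz /(hr _ wz) => {}hr.
  have wz0 : w - z != 0 by rewrite subr_eq0.
  have ne : cexp w - cexp z != 0.
    apply/eqP => e0; move: hr; rewrite e0 mul0r sub0r cabsN leNgt => /negP; apply.
    by move: n0; lra.
  rewrite /polar_quotient -[polar (E w)]/(cexp w) -[polar (E z)]/(cexp z).
  by field; rewrite wz0 ne.
have d2 : cderiv (fun w => cexp (c%:C * w)) z (c%:C * cexp (c%:C * z)).
  have := @cderiv_affine R (@cexp R) c%:C 0 z _ (cderiv_cexp _).
  by rewrite addr0 => h; apply: cderiv_ext h => w; rewrite addr0.
apply: cderiv_eq (cderivM d2 d1) _.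
by rewrite /polar_mellin; ring.
Qed.

Lemma cabs_cexp_scale x t : cabs (cexp (c%:C * (x +i* t))) = expR x `^ c.
Proof.
rewrite cabs_cexp /powR gt_eqF ?expR_gt0// expRK.
by congr expR => /=; rewrite mul0r subr0.
Qed.

Lemma cabs_logf (x t : R) : cabs (logf (x +i* t)) = expR x `^ c * cabs (f (expR x, t)).
Proof. by rewrite /logf cabsM cabs_cexp_scale. Qed.

(** Measurability on the ray of angle [t] and the substitution under dilations rest on this
    continuity. *)
Lemma continuous_modulus (t r : R) : 0 < r ->
  {for r, continuous (fun s => s `^ c * cabs (f (s, t)))}.
Proof.
move=> r0; apply/cvgrPdist_lt => e e0.
have [del d0 hd] := cderiv_continuous (cderiv_logf (ln r +i* t)) e0.
have := continuous_ln r0 => /cvgrPdist_lt/(_ _ d0) hln.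
near=> s.
have s0 : 0 < s by near: s; exact: lt_nbhsr.
have := cabs_logf (ln r) t; have := cabs_logf (ln s) t.
rewrite !lnK ?posrE// => <- <-.
have hs : cabs (logf (ln s +i* t) - logf (ln r +i* t)) < e.
  apply: hd; rewrite (le_lt_trans (horizontal_dist _ _ _))// distrC.
  by near: s.
rewrite ltr_norml; apply/andP; split.
  have := cabs_sub_le (logf (ln s +i* t)) (logf (ln r +i* t)); lra.
have := cabs_sub_le (logf (ln r +i* t)) (logf (ln s +i* t)); rewrite cabsC; lra.
Unshelve. all: by end_near. Qed.

Hypothesis T0 : 0 < T.
Variable C : R.
Hypothesis hC : forall r t : R, 0 < r -> r `^ c * cabs (f (r, t)) <= C * expR (T * `|t|).

Lemma bernstein_modulus (r t : R) n : 0 < r -> (0 < n)%N ->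
  r `^ c * cabs (polar_mellin c f (r, t)) <=
  T * \sum_(k < n) weight T k *
      (((r * expR (node T k)) `^ c * cabs (f (r * expR (node T k), t)) +
        (r * expR (- node T k)) `^ c * cabs (f (r * expR (- node T k), t))) / 2)
    + 128 * (C * expR (T * `|t|)) * T / n%:R.
Proof.
move=> r0 n0.
have hb (x y : R) : cabs (logf (x +i* y)) <= C * expR (T * `|y|).
  by rewrite cabs_logf hC// expR_gt0.
have := @bernstein_shift R T T0 logf _ C (ln r) t
  (fun z => ex_intro _ _ (cderiv_logf z)) (cderiv_logf _) hb n n0.
rewrite cabsM cabs_cexp_scale /E /= lnK ?posrE//.
congr (_ <= _ * _ + _); apply: eq_bigr => k _.
by rewrite !cabs_logf !expRD lnK ?posrE.
Qed.

End LogCoordinates.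

(** * Integration *)

Section Integral.
Context {R : realType}.
Notation mu := (@lebesgue_measure R).

Import HBNNSimple.

(** The integral of a nonnegative function is a supremum over the simple functions below it, hence
    monotone without measurability. This spares a measurability proof for the integrand built from
    [polar_mellin]. *)
Lemma ge0_le_integral_nomeas (D : set R) (f1 f2 : R -> \bar R) :
  (forall x, D x -> (0 <= f1 x)%E) -> (forall x, D x -> (f1 x <= f2 x)%E) ->
  (\int[mu]_(x in D) f1 x <= \int[mu]_(x in D) f2 x)%E.
Proof.
move=> f10 f12.
have f20 x : D x -> (0 <= f2 x)%E by move=> Dx; exact: le_trans (f10 _ Dx) (f12 _ Dx).
rewrite !ge0_integralE//; apply: ereal_sup_le => _ [h /= hf <-].
exists h => //= x; apply: (le_trans (hf x)).
by rewrite /patch; case: ifPn => // /[!inE] Dx; exact: f12.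
Qed.

(** Where [g x > 0] the power is differentiable; at a zero of [g], continuity comes from [t^q <= t]
    for [0 <= t <= 1]. *)
Lemma continuous_ge0_powR (g : R -> R) (q x : R) : 1 <= q -> (forall y, 0 <= g y) ->
  {for x, continuous g} -> {for x, continuous (fun y => g y `^ q)}.
Proof.
move=> q1 g0 cg; have q0 : 0 < q by lra.
have [gx0|gx0] := eqVneq (g x) 0.
  apply/cvgrPdist_lt => e e0; rewrite gx0 powR0 ?gt_eqF//.
  have m0 : 0 < Num.min e 1 by rewrite lt_min e0 ltr01.
  move/cvgrPdist_lt : cg => /(_ _ m0); apply: filterS => y.
  rewrite gx0 !sub0r !normrN (ger0_norm (g0 y)) (ger0_norm (powR_ge0 _ _)) lt_min.
  move=> /andP[ye y1]; have [->|gy0] := eqVneq (g y) 0; first by rewrite powR0 ?gt_eqF.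
  apply: le_lt_trans ye; rewrite -[leRHS]powRr1//; apply: ger_powR => //.
  by rewrite lt_def gy0 g0 ltW.
have gx : 0 < g x by rewrite lt_def gx0 g0.
have [d1 _] := is_derive1_powR q gx.
have h : {for g x, continuous (fun t => t `^ q)}.
  by apply: differentiable_continuous; apply/derivable1_diffP.
exact: (@cvg_comp R R R g (fun t => t `^ q) _ _ _ cg h).
Qed.

Lemma continuous_pos_measurable (g : R -> R) : (forall x, 0 < x -> {for x, continuous g}) ->
  measurable_fun (@halfline R) g.
Proof.
move=> h; apply: subspace_continuous_measurable_fun; first exact: measurable_itv.
apply: continuous_in_subspaceT => x; rewrite inE /halfline /= in_itv/= andbT; exact: h.
Qed.

(* The substitution rule of the library wants continuity up to the left end point,
   so the half-line is exhausted by the intervals [1/(n+1), +oo[. *)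
Lemma integral_dilation_le (psi : R -> R) (l : R) : 0 < l -> (forall x, 0 <= psi x) ->
  (forall x, 0 < x -> {for x, continuous psi}) ->
  (\int[mu]_(r in @halfline R) (psi (r * l) / r)%:E <=
   \int[mu]_(r in @halfline R) (psi r / r)%:E)%E.
Proof.
move=> l0 psi0 cpsi.
pose F (n : nat) : set R := [set` `[n.+1%:R^-1, +oo[].
have bigF : \bigcup_n F n = @halfline R.
  apply/seteqP; split => x; rewrite /halfline /F /= in_itv/= andbT.
    by move=> [n _]; rewrite /= in_itv/= andbT; apply: lt_le_trans; rewrite invr_gt0 ltr0n.
  move=> x0; exists (Num.truncn x^-1) => //=; rewrite in_itv/= andbT.
  by rewrite -[leRHS]invrK lef_pV2 ?posrE ?invr_gt0 ?ltr0n// ltW// truncnS_gt.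
have cquot (g : R -> R) (x : R) : 0 < x -> {for x, continuous g} ->
    {for x, continuous (fun r : R => g r / r)}.
  move=> x0 cg; apply: continuousM => //; apply: continuousV => //; exact: lt0r_neq0.
have cdil (x : R) : 0 < x -> {for x, continuous (fun r : R => psi (r * l))}.
  move=> x0; have h1 : {for x, continuous (fun r : R => r * l)}.
    by apply: continuousM => //; exact: cst_continuous.
  have h2 : {for x * l, continuous psi} by apply: cpsi; rewrite mulr_gt0.
  exact: (@cvg_comp R R R (fun r => r * l) psi _ _ _ h1 h2).
have mq : measurable_fun (@halfline R) (fun r => (psi (r * l) / r)%:E).
  apply/measurable_EFinP; apply: continuous_pos_measurable => x x0.
  by apply: cquot => //; exact: cdil.
have Fpos n x : F n x -> 0 < x.
  by rewrite /F /= in_itv/= andbT; apply: lt_le_trans; rewrite invr_gt0 ltr0n.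
have subF n : F n `<=` @halfline R.
  by move=> x /Fpos; rewrite /halfline /= in_itv/= andbT.
have cvgF : (\int[mu]_(r in F i) (psi (r * l) / r)%:E @[i --> \oo] -->
    \int[mu]_(r in \bigcup_i F i) (psi (r * l) / r)%:E)%E.
  apply: ge0_nondecreasing_set_cvg_integral.
  - move=> m n mn; apply/subsetPset => x; rewrite /F /= !in_itv/= !andbT.
    by apply: le_trans; rewrite lef_pV2 ?posrE ?ltr0n// ler_nat.
  - by move=> i; exact: measurable_itv.
  - by move=> i; apply: measurable_funS mq => //; exact: measurable_itv.
  - by move=> i x /Fpos x0; rewrite lee_fin divr_ge0// ltW.
rewrite -bigF -(cvg_lim _ cvgF)//; apply: lime_le.
  by apply/cvg_ex; eexists; exact: cvgF.
apply: nearW => n; rewrite bigF.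
have a0 : 0 < n.+1%:R^-1 :> R by rewrite invr_gt0 ltr0n.
set a : R := n.+1%:R^-1 in a0.
pose G s := psi s / s.
have dF x : is_derive x (1 : R) (fun r : R => r * l) l.
  by apply: is_derive_eq; rewrite /GRing.scale/= mulr0 add0r mulr1.
have dFE : derive1 (fun r : R => r * l) = cst l.
  by apply/funext => x; rewrite derive1E; have [_] := dF x.
have contF (x : R) : {for x, continuous (fun r : R => r * l)}.
  by apply: continuousM => //; exact: cst_continuous.
have := @increasing_ge0_integration_by_substitutiony R (fun r => r * l) G a.
rewrite dFE => H.
have -> : (\int[mu]_(r in F n) (psi (r * l) / r)%:E =
    \int[mu]_(x in `[(a * l)%R, +oo[) (G x)%:E)%E.
  rewrite H; last first.
  - by move=> x; rewrite in_itv/= andbT => ax; rewrite /G divr_ge0// ltW// (lt_trans _ ax)// mulr_gt0.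
  - apply: continuous_in_subspaceT => x; rewrite inE /= in_itv/= andbT => ax.
    have x0 : 0 < x by rewrite (lt_le_trans _ ax)// mulr_gt0.
    by apply: cquot => //; exact: cpsi.
  - by apply: gt0_cvgMly => //; exact: cvg_id.
  - split; first by move=> x _; have [] := dF x.
    exact: cvg_at_right_filter (contF a).
  - by apply/cvg_ex; exists l; exact: cvg_cst.
  - by apply/cvg_ex; exists l; exact: cvg_cst.
  - by move=> x _; exact: cst_continuous.
  - by move=> x y _ _ xy; rewrite ltr_pM2r.
  apply: eq_integral => x; rewrite inE => /Fpos x0; congr EFin.
  by rewrite [RHS](_ : _ = psi (x * l) / (x * l) * l)//; field; rewrite !gt_eqF.
(* The dilated interval stays inside the half-line and the integrand is nonnegative there. *)
rewrite /G; apply: ge0_subset_integral => //; [exact: measurable_itv..| | |].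
- apply/measurable_EFinP; apply: continuous_pos_measurable => x x0.
  by apply: cquot => //; exact: cpsi.
- by move=> x; rewrite /halfline /= in_itv/= andbT => x0; rewrite lee_fin divr_ge0// ltW.
- move=> x; rewrite /halfline /= !in_itv/= !andbT; apply: lt_le_trans.
  by rewrite mulr_gt0.
Qed.

(** The error [e / n] is additive for [B] but not for its power. If the series is finite, convexity
    bounds [T] times each partial sum by one and the same [q]-th root; then [n] tends to infinity in
    the bound for [B], and the power is taken last. *)
Lemma powR_series_le (T B r q e : R) (w a b : nat -> R) : 0 <= T -> 0 <= B -> 0 < r ->
  1 <= q -> (forall k, 0 <= w k) -> (forall k, 0 <= a k) ->
  (forall n, \sum_(k < n) w k <= 1) -> (forall k, a k `^ q <= b k) ->
  (forall n, (0 < n)%N -> B <= T * \sum_(k < n) w k * a k + e / n%:R) ->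
  ((B `^ q / r)%:E <= \sum_(k <oo) (T `^ q * (w k * b k) / r)%:E)%E.
Proof.
move=> T0 B0 r0 q1 w0 a0 w1 ab hB; have q0 : 0 < q by lra.
have b0 k : 0 <= b k by apply: le_trans (ab k); exact: powR_ge0.
have t0 k : (0 <= (T `^ q * (w k * b k) / r)%:E)%E.
  by rewrite lee_fin divr_ge0 ?(ltW r0)// mulr_ge0 ?powR_ge0// mulr_ge0.
have S0 : (0 <= \sum_(k <oo) (T `^ q * (w k * b k) / r)%:E)%E.
  by apply: nneseries_ge0 => n _ _; exact: t0.
have hS n : (\sum_(0 <= k < n) (T `^ q * (w k * b k) / r)%:E <=
    \sum_(k <oo) (T `^ q * (w k * b k) / r)%:E)%E.
  by apply: nneseries_lim_ge => k _ _; exact: t0.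
move: hS S0; set S := (\sum_(k <oo) _)%E; case: S => [s| |] hS S0; last by [].
  rewrite lee_fin in S0; rewrite lee_fin ler_pdivrMr//.
  have sr0 : 0 <= s * r by rewrite mulr_ge0// ltW.
  have hm n : T * \sum_(k < n) w k * a k <= (s * r) `^ q^-1.
    have m0 : 0 <= T * \sum_(k < n) w k * a k.
      by rewrite mulr_ge0// sumr_ge0// => k _; rewrite mulr_ge0.
    have : (T * \sum_(k < n) w k * a k) `^ q <= s * r.
      have := hS n; rewrite sumEFin lee_fin big_mkord -mulr_suml ler_pdivrMr//.
      apply: le_trans; rewrite -mulr_sumr powRM//; last first.
        by rewrite sumr_ge0// => k _; rewrite mulr_ge0.
      rewrite ler_wpM2l ?powR_ge0//; apply: (le_trans (powR_sum_le q1 w0 a0 (w1 n))).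
      by apply: ler_sum => k _; rewrite ler_wpM2l.
    move=> /(ge0_ler_powR (r := q^-1)); rewrite !nnegrE powR_ge0 sr0 invr_ge0 (ltW q0).
    by move=> /(_ isT isT isT); rewrite -powRrM divff ?gt_eqF// powRr1.
  have Bs : B <= (s * r) `^ q^-1.
    apply: (@le_of_le_invn R _ _ e) => n n0; apply: (le_trans (hB n n0)).
    by rewrite lerD2r.
  have := ge0_ler_powR (ltW q0) B0 (powR_ge0 (s * r) q^-1) Bs.
  by rewrite -powRrM mulVf ?gt_eqF// powRr1.
by rewrite leey.
Qed.

End Integral.

(** * From the pointwise bound to the norms *)

Lemma lee_mulD_double (R : realType) (k : R) (x y z : \bar R) : 0 <= k ->
  (0 <= z)%E -> (x <= z)%E -> (y <= z)%E -> (k%:E * (x + y) <= (k * 2)%:E * z)%E.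
Proof.
move=> k0 z0 xz yz; apply: (@le_trans _ _ (k%:E * (z + z))%E).
  by apply: lee_wpmul2l; [rewrite lee_fin|exact: leeD].
by rewrite ge0_muleDr// -ge0_muleDl ?lee_fin// -EFinD -mulr2n mulr_natr.
Qed.

Theorem corollary1 (R : realType) (p : \bar R) (c T : R) (f : R * R -> R[i])
    (hp : (1 <= p)%E) (hT : 0 < T) (hf : mellin_bernstein c p T f)
    (theta : R) :
  (Xnorm c p (fun r => polar_mellin c f (r, theta))
     <= T%:E * Xnorm c p (fun r => f (r, theta)))%E.
Proof.
case: hf => fa _ [C C0 hC].
pose A (s : R) := s `^ c * cabs (f (s, theta)).
pose B (s : R) := s `^ c * cabs (polar_mellin c f (s, theta)).
have A0 s : 0 <= A s by rewrite mulr_ge0 ?powR_ge0 ?cabs_ge0.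
have B0 s : 0 <= B s by rewrite mulr_ge0 ?powR_ge0 ?cabs_ge0.
pose l (k : nat) := expR (node T k); pose l' (k : nat) := expR (- node T k).
have hB r n : 0 < r -> (0 < n)%N ->
    B r <= T * \sum_(k < n) weight T k * ((A (r * l k) + A (r * l' k)) / 2)
      + 128 * (C * expR (T * `|theta|)) * T / n%:R.
  by move=> r0 n0; exact: (bernstein_modulus fa hT hC theta r0 n0).
have hD (r : R) : @halfline R r -> 0 < r by rewrite /halfline /= in_itv/= andbT.
case: p hp => [q| |] hp; last by move: hp; rewrite leeNy_eq.
- rewrite lee_fin in hp; have q0 : 0 < q by lra.
  have normE g : Xnorm c q%:E g = poweR (\int[lebesgue_measure]_(r in @halfline R)
      ((r `^ c * cabs (g r)) `^ q / r)%:E)%E q^-1.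
    congr poweR; apply: eq_integral => r _; congr (_ / _)%:E.
    by rewrite powRM ?powR_ge0 ?cabs_ge0// powRrM.
  rewrite !normE; set I := (\int[_]_(r in _) _)%E; set J := (\int[_]_(r in _) _)%E.
  have J0 : (0 <= J)%E.
    by apply: integral_ge0 => r /hD r0; rewrite lee_fin divr_ge0 ?powR_ge0// ltW.
  have I0 : (0 <= I)%E.
    by apply: integral_ge0 => r /hD r0; rewrite lee_fin divr_ge0 ?powR_ge0// ltW.
  pose psi (s : R) := A s `^ q.
  have psi0 s : 0 <= psi s := powR_ge0 _ _.
  have cpsi s : 0 < s -> {for s, continuous psi}.
    by move=> s0; apply: continuous_ge0_powR => //; exact: continuous_modulus.
  pose U (m r : R) := psi (r * m) / r.
  have U0 m r : @halfline R r -> 0 <= U m r by move=> /hD r0; rewrite divr_ge0// ltW.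
  have mhl : measurable (@halfline R) by exact: measurable_itv.
  have mU m : 0 < m -> measurable_fun (@halfline R) (U m).
    move=> m0; apply: continuous_pos_measurable => r r0.
    apply: continuousM; last by apply: continuousV => //; exact: lt0r_neq0.
    have h1 : {for r, continuous (fun s : R => s * m)}.
      by apply: continuousM => //; exact: cst_continuous.
    have h2 : {for r * m, continuous psi} by apply: cpsi; rewrite mulr_gt0.
    exact: (@cvg_comp R R R (fun s => s * m) psi _ _ _ h1 h2).
  have UJ m : 0 < m -> (\int[lebesgue_measure]_(r in @halfline R) (U m r)%:E <= J)%E.
    by move=> m0; exact: integral_dilation_le.
  clearbody J.
  pose t k r := T `^ q * (weight T k * ((psi (r * l k) + psi (r * l' k)) / 2)) / r.
  have tE k r : t k r = T `^ q * weight T k / 2 * (U (l k) r + U (l' k) r).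
    rewrite /t /U; move: (psi (r * _)) (psi (r * _)) (T `^ q) (weight T k).
    by move=> x y u v; ring.
  have k0 k : 0 <= T `^ q * weight T k / 2.
    by rewrite divr_ge0// mulr_ge0 ?powR_ge0 ?weight_ge0.
  have lg k : 0 < l k := expR_gt0 _. have lg' k : 0 < l' k := expR_gt0 _.
  have mt k : measurable_fun (@halfline R) (fun r => (t k r)%:E).
    apply/measurable_EFinP; rewrite (funext (tE k)).
    apply: measurable_funM; first exact: measurable_cst.
    by apply: measurable_funD; exact: mU.
  have t0 k r : @halfline R r -> (0 <= (t k r)%:E)%E.
    by move=> hr; rewrite lee_fin tE mulr_ge0// addr_ge0// U0.
  (* The series bound is integrated term by term: each dilate of [psi] contributes at most [J], and
     the weights sum to at most 1. [J] may be infinite. *)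
  have IT : (I <= (T `^ q)%:E * J)%E.
    apply: (@le_trans _ _ (\int[lebesgue_measure]_(r in @halfline R)
        (\sum_(k <oo) (t k r)%:E))%E).
      apply: ge0_le_integral_nomeas => r /hD r0.
        by rewrite lee_fin divr_ge0 ?powR_ge0// ltW.
      apply: (@powR_series_le _ T (B r) r q (128 * (C * expR (T * `|theta|)) * T)
        (weight T) (fun k => (A (r * l k) + A (r * l' k)) / 2)) => //.
      - exact: ltW.
      - by move=> k; exact: weight_ge0.
      - by move=> k; rewrite divr_ge0// addr_ge0.
      - by move=> n; exact: sum_weight_le1.
      - by move=> k; exact: powR_half_le.
      - by move=> n n0; exact: hB.
    rewrite integral_nneseries//.
    have tJ k : (\int[lebesgue_measure]_(r in @halfline R) (t k r)%:E <=
        (T `^ q * weight T k)%:E * J)%E.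
      under eq_integral do rewrite tE EFinM EFinD.
      rewrite ge0_integralZl//=; last 3 first.
      - by apply: emeasurable_funD; apply/measurable_EFinP; exact: mU.
      - by move=> r hr; rewrite -EFinD lee_fin addr_ge0// U0.
      - by rewrite lee_fin.
      rewrite ge0_integralD//=; last 4 first.
      - by move=> r hr; rewrite lee_fin U0.
      - by apply/measurable_EFinP; exact: mU.
      - by move=> r hr; rewrite lee_fin U0.
      - by apply/measurable_EFinP; exact: mU.
      have := k0 k; set K := T `^ q * weight T k / 2 => K0.
      have -> : T `^ q * weight T k = K * 2 by rewrite /K divfK.
      by apply: lee_mulD_double => //; exact: UJ.
    apply: lime_le.
      apply: is_cvg_nneseries => k _ _.
      by apply: integral_ge0 => r hr; exact: t0.
    apply: nearW => n; rewrite big_mkord.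
    apply: (@le_trans _ _ (\sum_(k < n) (T `^ q * weight T k)%:E * J)%E).
      by apply: lee_sum => k _; exact: tJ.
    rewrite -ge0_sume_distrl; last first.
      by move=> k _; rewrite lee_fin mulr_ge0 ?powR_ge0 ?weight_ge0.
    rewrite sumEFin -mulr_sumr lee_wpmul2r// lee_fin.
    by rewrite ler_piMr ?powR_ge0// sum_weight_le1.
  clearbody I; have T0 := ltW hT.
  have : (poweR I q^-1 <= poweR ((T `^ q)%:E * J) q^-1)%E.
    apply: gt0_ler_poweR => //; rewrite ?invr_ge0 ?(ltW q0)// ?in_itv/= ?I0 ?leey//.
    by rewrite mule_ge0// lee_fin powR_ge0.
  rewrite poweRM// ?lee_fin ?powR_ge0// poweR_EFin -powRrM divff ?gt_eqF// powRr1//.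
- rewrite /Xnorm -/A.
  set S := (X in (_ <= _ * X)%E).
  (* Dilations preserve the half-line, so the supremum bounds all the dilates [A (r * l k)] and
     [A (r * l' k)] at once. *)
  have hS r : 0 < r -> ((A r)%:E <= S)%E.
    move=> r0; apply: ereal_sup_ubound; exists r => //.
    by rewrite /halfline /= in_itv/= andbT.
  have S0 : (0 <= S)%E by apply: le_trans (hS 1 ltr01); rewrite lee_fin.
  apply: ge_ereal_sup => _ [r /hD r0 <-].
  (* For [S = +oo] the right-hand side is infinite because [T > 0]. *)
  case: S hS S0 => [s| |] hS S0 //; last by rewrite gt0_muley ?lte_fin// leey.
  rewrite -EFinM lee_fin -/(B r).
  apply: (@le_of_le_invn R _ _ (128 * (C * expR (T * `|theta|)) * T)) => n n0.
  apply: (le_trans (hB r n r0 n0)); rewrite lerD2r ler_pM2l//.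
  apply: (@le_trans _ _ (\sum_(k < n) weight T k * s)).
    apply: ler_sum => k _; rewrite ler_wpM2l ?weight_ge0//.
    have h1 := hS (r * l k); have h2 := hS (r * l' k).
    rewrite !lee_fin !mulr_gt0 ?expR_gt0// in h1 h2.
    by have := h1 isT; have := h2 isT; lra.
  by rewrite -mulr_suml ler_piMl// sum_weight_le1.
Qed.
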